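(* Let $R=(R_t)_{t\ge0}$ be a Lévy process with Lévy–Itô decomposition $$R_t=\mu t+\sigma B_t+\int_0^t\int_{0<|x|\le1}x\big(\mu^R(dx,ds)-F^R(dx)\,ds\big)+\int_0^t\int_{|x|>1}x\,\mu^R(dx,ds),$$ and, for $f\in[0,1]$, let $$W^f_t=\exp\left(fR_t+\frac{f(1-f)\sigma^2}{2}\,t+\int_0^t\int_{\mathbb{R}\setminus\{0\}}\Big[\ln\big(1+f(e^x-1)\big)-fx\Big]\mu^R(dx,ds)\right).$$ If $\mathbb{E}|R_1|<\infty$, then, with probability one, $$\lim_{t\to+\infty}\frac{\ln W_t^f}{t}=f\bigg(\mu+\int_{|x|>1}x\,F^R(dx)\bigg)+\frac{f(1-f)\sigma^2}{2}+\int_{\mathbb{R}\setminus\{0\}}\Big[\ln\big(1+f(e^x-1)\big)-fx\Big]F^R(dx).$$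
   Context: Here $\mu\in\mathbb{R}$, $\sigma\ge0$, $B$ is a standard Brownian motion, $\mu^R(dx,ds)=\sum_{s>0:\,\triangle R_s\neq0}\delta_{(\triangle R_s,s)}(dx,ds)$ is the jump measure of $R$ (with $\triangle R_s=R_s-R_{s-}$), and $F^R$ is the Lévy measure of $R$ on $\mathbb{R}\setminus\{0\}$. *)

(* Defs.v *)
From HB Require Import structures.
From mathcomp Require Import all_boot all_order all_algebra.
From mathcomp Require Import all_classical all_reals all_analysis.
From mathcomp Require Import measurable_realfun.
Set Implicit Arguments.
Unset Strict Implicit.
Unset Printing Implicit Defensive.
Import Order.TTheory GRing.Theory Num.Theory.
Import numFieldNormedType.Exports.
Local Open Scope classical_set_scope.
Local Open Scope ring_scope.

(** * Paths and their jump measure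

    Time is a real number; only the values of a path at nonnegative times
    matter. *)

Section paths.
Context {R : realType}.
Implicit Type x : R -> R.

Definition cadlag x :=
  (forall t, 0 <= t -> x s @[s --> t^'+] --> x t) /\
  (forall t, 0 < t -> cvg (x s @[s --> t^'-])).

Definition jump x (s : R) : R := x s - lim (x u @[u --> s^'-]).

Definition jump_times x : set R := [set s | 0 < s /\ jump x s != 0].

(* The pair is ordered as in $\mu^R(dx,ds)$: jump size first, then time. *)
Definition jump_measure x (A : set (R * R)) : \bar R :=
  (\esum_(s in jump_times x) \d_(jump x s, s) A)%E.

Section jump_measure_is_measure.
Local Open Scope ereal_scope.
Variable x : R -> R.

Let jump_measure0 : jump_measure x set0 = 0.
Proof. by rewrite /jump_measure esum1// => s _; rewrite dirac0. Qed.

Let jump_measure_ge0 A : 0 <= jump_measure x A.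
Proof. by apply: esum_ge0 => s _. Qed.

Let jump_measure_sigma_additive : semi_sigma_additive (jump_measure x).
Proof.
move=> F mF tF mUF.
rewrite [X in _ --> X](_ : _ = \sum_(n <oo) jump_measure x (F n)).
  by apply/cvg_closeP; split; [exact: is_cvg_nneseries|rewrite closeE].
rewrite nneseries_esumT// /jump_measure esum_esum//.
rewrite (reindex_esum (jump_times x `*`` (fun=> [set: nat])) _
  (fun z => (z.2, z.1))); last 1 first.
- split=> [[s n] []//|[s n] [s' n'] _ _ [-> ->]//|[n s] [_ /= xs]].
  by exists (s, n).
rewrite -(esum_esum (J := fun=> [set: nat])
  (a := fun s n => \d_(jump x s, s) (F n)))//.
apply: eq_esum => s _; rewrite -nneseries_esumT//.
by apply/esym/cvg_lim => //; exact: measure_semi_sigma_additive.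
Qed.

HB.instance Definition _ := isMeasure.Build _ _ _ (jump_measure x)
  jump_measure0 jump_measure_ge0 jump_measure_sigma_additive.

End jump_measure_is_measure.

End paths.

(** * Independence *)

Section independence.
Context d (T : measurableType d) (R : realType) (P : probability T R).

(* The product rule for subfamilies is the case where some [U i] are [setT]. *)
Definition mutually_independent d' (E : measurableType d') n
    (X : 'I_n -> T -> E) :=
  forall U : 'I_n -> set E, (forall i, measurable (U i)) ->
  P (\bigcap_i (X i @^-1` U i)) = (\prod_(i < n) P (X i @^-1` U i))%E.

Definition sigma_generated d' (E : measurableType d') (I : Type) (D : set I)
    (X : I -> T -> E) : set (set T) :=
  <<s \bigcup_(i in D) preimage_set_system setT (X i) measurable >>.

Definition independent_systems (G H : set (set T)) :=
  forall A B, G A -> H B -> P (A `&` B) = (P A * P B)%E.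

End independence.

(** * Lévy processes, Brownian motion, Poisson random measures *)

Section processes.
Context d (T : measurableType d) (R : realType) (P : probability T R).
Implicit Type X : R -> T -> R.

Definition independent_increments X :=
  forall n (t : nat -> R), 0 <= t 0%N ->
  (forall i, (i < n)%N -> t i <= t i.+1) ->
  mutually_independent P (fun (i : 'I_n) w => X (t i.+1) w - X (t i) w).

Record levy_process X : Prop := LevyProcess {
  levy_measurable : forall t : R, 0 <= t -> measurable_fun setT (X t) ;
  levy_start : {ae P, forall w, X 0 w = 0} ;
  levy_independent : independent_increments X ;
  levy_stationary : forall s h : R, 0 <= s -> 0 <= h -> forall U : set R,
    measurable U -> P [set w | U (X (s + h) w - X s w)] = P (X h @^-1` U) ;
  levy_stochastic_continuity : forall t e : R, 0 <= t -> 0 < e ->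
    P [set w | e < `|X s w - X t w|]
      @[s --> within `[0, +oo[ (nbhs t)] --> 0%E ;
  levy_cadlag : {ae P, forall w, cadlag (X ^~ w)}
}.

Record standard_brownian_motion X : Prop := StandardBrownianMotion {
  brownian_measurable : forall t : R, 0 <= t -> measurable_fun setT (X t) ;
  brownian_start : {ae P, forall w, X 0 w = 0} ;
  brownian_independent : independent_increments X ;
  brownian_gaussian : forall s t : R, 0 <= s -> s < t -> forall U : set R,
    measurable U ->
    P [set w | U (X t w - X s w)] = normal_prob 0 (Num.sqrt (t - s)) U ;
  brownian_continuous :
    {ae P, forall w, {within `[0, +oo[, continuous (X ^~ w)}}
}.

(* The Poisson law is written out because [poisson_pmf] is 1 at rate 0;
   here rate 0 gives the point mass at 0, since 0 ^+ 0 = 1. *)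
Record poisson_random_measure d' (E : measurableType d')
    (N : T -> set E -> \bar R) (lambda : set E -> \bar R) : Prop :=
  PoissonRandomMeasure {
  prm_measurable : forall A, measurable A -> measurable_fun setT (N ^~ A) ;
  prm_poisson : forall A, measurable A -> (lambda A < +oo)%E -> forall k : nat,
    P [set w | N w A = k%:R%:E] =
    (fine (lambda A) ^+ k / k`!%:R * expR (- fine (lambda A)))%:E ;
  prm_infinite : forall A, measurable A -> lambda A = +oo%E ->
    {ae P, forall w, N w A = +oo%E} ;
  prm_independent : forall n (A : 'I_n -> set E),
    (forall i, measurable (A i)) -> trivIset setT A ->
    mutually_independent P (fun i w => N w (A i))
}.

End processes.

(** * Lévy-Itô decomposition *)

Section levy_ito.
Context d (T : measurableType d) (R : realType) (P : probability T R).
Variable X : R -> T -> R.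
Implicit Type F : {measure set R -> \bar R}.

(* A measure on $\mathbb{R}\setminus\{0\}$ is represented as a measure on [R];
   the first field forces [F [set 0] = 0]. *)
Record levy_measure F : Prop := LevyMeasure {
  levy_measureE : forall A, measurable A ->
    F A = (\int[P]_w jump_measure (X ^~ w) (A `*` `]0%R, 1%R]))%E ;
  levy_measure_integrable : (\int[F]_x (Num.min 1 (x ^+ 2))%:E < +oo)%E
}.

(* $F(dx)\,ds$ on $\mathbb{R}\times(0,\infty)$ *)
Definition jump_intensity F (A : set (R * R)) : \bar R :=
  ((F \x lebesgue_measure) (A `&` (setT `*` `]0%R, +oo[)))%E.

(* $\int_0^t\int_D g(x)\,\mu^X(dx,ds)$ *)
Definition jump_integral (D : set R) (g : R -> R) (t : R) (w : T) : R :=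
  \int[jump_measure (X ^~ w)]_(z in D `*` `]0, t]) g z.1.

Definition truncated_compensated_jumps F (e t : R) (w : T) : R :=
  jump_integral [set x | e < `|x| <= 1] id t w -
  \int[lebesgue_measure]_(s in `]0%R, t])
    \int[F]_(x in [set x | e < `|x| <= 1]) x.

(* [M t] is
   $\int_0^t\int_{0<|x|\le1}x\,(\mu^X(dx,ds)-F(dx)\,ds)$, that is, a
   right-continuous version of the L2-limit of the truncated integrals; the
   two integrals need not exist separately. *)
Record compensated_small_jumps F (M : R -> T -> R) : Prop :=
  CompensatedSmallJumps {
  compensated_measurable : forall t : R, 0 <= t -> measurable_fun setT (M t) ;
  compensated_cadlag : {ae P, forall w, cadlag (M ^~ w)} ;
  compensated_cvg : forall t : R, 0 <= t ->
    (\int[P]_w ((truncated_compensated_jumps F e t w - M t w) ^+ 2)%:E)%E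
      @[e --> 0^'+] --> 0%E
}.

Record levy_ito_decomposition (mu sigma : R) (B : R -> T -> R) F : Prop :=
  LevyItoDecomposition {
  levy_ito_measure : levy_measure F ;
  levy_ito_brownian : standard_brownian_motion P B ;
  levy_ito_poisson : poisson_random_measure P
    (fun w => jump_measure (X ^~ w)) (jump_intensity F) ;
  levy_ito_independent : independent_systems P
    (sigma_generated `[0, +oo[ B)
    (sigma_generated measurable (fun A w => jump_measure (X ^~ w) A)) ;
  levy_itoE : exists2 M, compensated_small_jumps F M &
    {ae P, forall w, forall t : R, 0 <= t ->
      X t w = mu * t + sigma * B t w + M t w
              + jump_integral [set x | 1 < `|x|] id t w}
}.

Definition log_jump (f x : R) : R := ln (1 + f * (expR x - 1)) - f * x.

Definition wealth (sigma f t : R) (w : T) : R :=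
  expR (f * X t w + f * (1 - f) * sigma ^+ 2 / 2 * t
        + jump_integral (~` [set 0]) (log_jump f) t w).

End levy_ito.

(* Main.v *)
(** The process [ln W^f_t] is the sum of [f R_t], of a linear term, and of
    the integral over (0,t] of [log_jump f], which is nonnegative, against the
    jump measure.  Each time average is controlled by second moments alone.

    The jumps up to time t form a Poisson random measure on R with intensity
    [t F], so that Campbell's formulas give the mean and the variance of
    integrals against it.  For [g >= 0] with [m = \int g dF] finite, truncating
    at the level [g <= q^k] bounds the probability that the integral of [g]
    over (0,s], with [s <= q^k], deviates from [s m] by more than [e q^k]; the
    bounds are summable in k, because [\sum_k q^k 1(q^k < u)] and
    [\sum_k u^2 q^-k 1(u <= q^k)] are both O(u).  For monotone integrals,
    Borel-Cantelli along [q^k] and [q -> 1] then give the law of large numbers,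
    as in Etemadi's proof.

    The Brownian part and the compensated small jumps have variances O(t), so
    the deviations of [R_s - s E R_1] for [s <= 2^k] are also summable in k,
    uniformly in s.  Independence and stationarity of the increments of R turn
    this into a bound on the supremum over [0,2^k] (Etemadi's maximal
    inequality on dyadic grids), hence [R_t / t -> E R_1].

    Big jumps are integrable: on the event that the only big jumps before time
    1 have a given sign and size at most n, their sum is its own absolute
    value, and that event is independent of the jumps that are summed. *)
Require Import Defs.
From HB Require Import structures.
From mathcomp Require Import all_boot all_order all_algebra.
From mathcomp Require Import all_classical all_reals all_analysis.
From mathcomp Require Import measurable_realfun.
From mathcomp Require Import ring lra.
Set Implicit Arguments.
Unset Strict Implicit.
Unset Printing Implicit Defensive.
Import Order.TTheory GRing.Theory Num.Theory.
Import numFieldNormedType.Exports.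
Local Open Scope classical_set_scope.
Local Open Scope ring_scope.

(** * Mixtures of measures, densities and Poisson sums *)

(** Only the first moment of R_1 is assumed, so the big jumps and their logarithmic versions may
    have infinite variance; truncating at the level of the time scale is what lets second moments
    suffice. Integrals that are monotone in time can be interpolated between the times q^k, but R is
    not monotone and needs a maximal inequality. That inequality is applied to R and not to its
    parts: the compensated integral M is given at each fixed time as an L2 limit, with no statement
    about its increments, whereas R has independent stationary increments by definition. All it asks
    of the parts is a deviation bound uniform in s <= 2^k, which a union bound supplies.

    Second moments of Poisson integrals come from size biasing: under a weight that is itself an
    integral against the random measure, the mean measure is explicit, so that the mean formula
    applied repeatedly gives the variance, even when F is infinite near 0.

    Real-valued integrals are [fine] of extended ones, hence 0 where the latter are infinite.
    Finiteness has to come first, and some identities between paths hold only almost surely. *)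

Section measurable_comparison.
Context d (T : measurableType d) (R : realType).
Implicit Types f g : T -> R.

Lemma measurable_set_le f g : measurable_fun setT f -> measurable_fun setT g ->
  measurable [set w | f w <= g w].
Proof.
by move=> mf mg; rewrite -[X in measurable X]setTI; exact: measurable_fun_le.
Qed.

Lemma measurable_set_lt f g : measurable_fun setT f -> measurable_fun setT g ->
  measurable [set w | f w < g w].
Proof.
move=> mf mg; rewrite (_ : [set w | _] = ~` [set w | g w <= f w]).
  by apply: measurableC; exact: measurable_set_le.
by apply/seteqP; split=> w /=; [rewrite ltNge => /negP|move/negP; rewrite -ltNge].
Qed.

End measurable_comparison.

Section mixture.
Local Open Scope ereal_scope.
Context d d' (T : measurableType d) (E : measurableType d') (R : realType).
Variables (P : {measure set T -> \bar R}) (K : T -> {measure set E -> \bar R}).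
Hypothesis mK : forall A, measurable A -> measurable_fun setT (K ^~ A).
Import HBNNSimple.

(** Monotone approximation by simple functions extends an identity from sets to integrals. The
    weight [D] serves second moments: when [D] is itself an integral against [K], a product of two
    integrals gets evaluated. *)
Lemma integral_mixture (D : T -> R) (nu : {measure set E -> \bar R})
    (h : E -> \bar R) :
  measurable_fun setT D -> (forall w, (0 <= D w)%R) ->
  (forall A, measurable A -> \int[P]_w ((D w)%:E * K w A) = nu A) ->
  measurable_fun setT h -> (forall x, 0 <= h x) ->
  \int[P]_w ((D w)%:E * \int[K w]_x h x) = \int[nu]_x h x.
Proof.
move=> mD D0 KE mh h0; pose k := nnsfun_approx measurableT mh.
have mk n : measurable_fun setT (EFin \o k n) by exact/measurable_EFinP.
have k0 n x : 0 <= (EFin \o k n) x by rewrite lee_fin.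
have ndk x m n : (m <= n)%N -> (EFin \o k m) x <= (EFin \o k n) x.
  by move=> mn; rewrite lee_fin; exact/lefP/nd_nnsfun_approx.
have cvgk (m : {measure set E -> \bar R}) :
    \int[m]_x (k n x)%:E @[n --> \oo] --> \int[m]_x h x.
  rewrite [X in _ --> X](_ : _ = \int[m]_x limn (fun n => (k n x)%:E)).
    apply: cvg_monotone_convergence => //.
    - by move=> n x _; exact: k0.
    - by move=> x _ a b; exact: ndk.
  apply: eq_integral => x _; apply/esym/cvg_lim => //.
  by apply: cvg_nnsfun_approx.
have mDE : measurable_fun setT (EFin \o D) by exact/measurable_EFinP.
have mint n : measurable_fun setT (fun w => \int[K w]_x (k n x)%:E).
  apply: (measurable_fun_integral_kernel mK) => [x|]; [exact: k0|exact: mk].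
have kE n : \int[P]_w ((D w)%:E * \int[K w]_x (k n x)%:E) = \int[nu]_x (k n x)%:E.
  rewrite integralT_nnsfun sintegralE.
  under eq_integral => w _.
    rewrite integralT_nnsfun sintegralE ge0_mule_fsumr; last first.
      by move=> r; exact: nnsfun_mulemu_ge0.
    over.
  have mpre r : measurable (k n @^-1` [set r]) by exact: measurable_sfunP.
  rewrite ge0_integral_fsum//; last 2 first.
    - move=> r; apply: emeasurable_funM => //; apply: measurable_funeM.
      exact: mK.
    - by move=> r w _; rewrite mule_ge0// ?lee_fin// nnsfun_mulemu_ge0.
  apply: eq_fsbigr => r _.
  have [r0|r0] := leP 0%R r; last first.
    rewrite (_ : k n @^-1` [set r] = set0); last first.
      by rewrite preimage_nnfun0.
    rewrite measure0 mule0 integral0_eq// => w _.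
    by rewrite measure0 !mule0.
  rewrite -KE// -ge0_integralZl//=; first last.
  - by move=> w _; rewrite mule_ge0// lee_fin.
  - by apply: emeasurable_funM => //; exact: mK.
  by apply: eq_integral => w _; rewrite muleCA.
suff Dk : \int[P]_w ((D w)%:E * \int[K w]_x (k n x)%:E) @[n --> \oo] -->
    \int[P]_w ((D w)%:E * \int[K w]_x h x).
  rewrite -(cvg_lim _ (cvgk nu))// -(cvg_lim _ Dk)//.
  by apply: congr_lim; apply/funext => n /=; rewrite kE.
rewrite [X in _ --> X](_ : _ =
    \int[P]_w limn (fun n => (D w)%:E * \int[K w]_x (k n x)%:E)).
  apply: cvg_monotone_convergence => //.
  - by move=> n; exact: emeasurable_funM.
  - move=> n w _; rewrite mule_ge0// ?lee_fin//.
    by apply: integral_ge0 => x _; exact: k0.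
  - move=> w _ a b ab; rewrite lee_wpmul2l// ?lee_fin//.
    apply: ge0_le_integral => //; [by move=> x _; exact: k0|exact: mk|exact: mk|].
    by move=> x _; exact: ndk.
apply: eq_integral => w _; apply/esym/cvg_lim => //.
by apply: cvgeZl => //; exact: cvgk.
Qed.

Lemma integral_kernel_mean (nu : {measure set E -> \bar R}) (h : E -> \bar R) :
  (forall A, measurable A -> \int[P]_w K w A = nu A) ->
  measurable_fun setT h -> (forall x, 0 <= h x) ->
  \int[P]_w \int[K w]_x h x = \int[nu]_x h x.
Proof.
move=> KE mh h0.
rewrite -(@integral_mixture (cst 1%R))//; last first.
  by move=> A mA; under eq_integral do rewrite mul1e; exact: KE.
by under [RHS]eq_integral do rewrite mul1e.
Qed.

Lemma mixture_measure (D : T -> R) :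
  measurable_fun setT D -> (forall w, (0 <= D w)%R) ->
  exists nu : {measure set E -> \bar R},
    forall A, nu A = \int[P]_w ((D w)%:E * K w A).
Proof.
move=> mD D0; pose m A := \int[P]_w ((D w)%:E * K w A).
have m0 : m set0 = 0.
  by rewrite /m integral0_eq// => w _; rewrite measure0 mule0.
have m_ge0 A : 0 <= m A.
  by apply: integral_ge0 => w _; rewrite mule_ge0// lee_fin.
have m_sigma : semi_sigma_additive m.
  move=> F mF tF mUF; rewrite [X in _ --> X](_ : _ = \sum_(n <oo) m (F n)).
    by apply/cvg_closeP; split; [exact: is_cvg_nneseries|rewrite closeE].
  rewrite -integral_nneseries//; last 2 first.
  - move=> n; apply: emeasurable_funM; last exact: mK.
    exact/measurable_EFinP.
  - by move=> n w _; rewrite mule_ge0// lee_fin.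
  apply: eq_integral => w _; rewrite nneseriesZl//.
  by rewrite measure_semi_bigcup// nneseries_esum.
pose nu : {measure set E -> \bar R} :=
  HB.pack m (isMeasure.Build _ _ _ m m0 m_ge0 m_sigma).
by exists nu.
Qed.

End mixture.

Section density.
Local Open Scope ereal_scope.
Context d (E : measurableType d) (R : realType).
Variable la : {measure set E -> \bar R}.

(** A measure with density [D] is the mixture of the Dirac masses at x with weight [D x], which
    makes the integration formula a case of [integral_mixture]. *)
Lemma density_measure (D : E -> R) :
  measurable_fun setT D -> (forall x, (0 <= D x)%R) ->
  exists nu : {measure set E -> \bar R},
    (forall A, measurable A -> nu A = \int[la]_(x in A) (D x)%:E) /\
    (forall h, measurable_fun setT h -> (forall x, 0 <= h x) ->
      \int[nu]_x h x = \int[la]_x ((D x)%:E * h x)).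
Proof.
move=> mD D0; pose K (x : E) : {measure set E -> \bar R} := \d_x.
have mK A : measurable A -> measurable_fun setT (K ^~ A).
  by move=> mA; apply/measurable_EFinP; exact: measurable_indic.
have [nu nuE] := mixture_measure la mK mD D0.
exists nu; split => [A mA|h mh h0].
  rewrite nuE [RHS]integral_mkcond; apply: eq_integral => x _.
  by rewrite [K x A]diracE patchE; case: ifPn => _; rewrite ?mule1 ?mule0.
rewrite -(integral_mixture mK mD D0 (fun A _ => esym (nuE A)) mh h0).
by apply: eq_integral => x _; rewrite /K integral_dirac// diracT mul1e.
Qed.

End density.

Section discrete.
Local Open Scope ereal_scope.
Context d (T : measurableType d) (R : realType) (P : probability T R).

(** As the [p k] sum to 1, the sets [F k] cover the space up to a null set. This matters for Poisson
    counts, which are finite integers only almost surely. *)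
Lemma ge0_integral_partition (F : (set T)^nat) (Z : T -> \bar R) (c p : nat -> \bar R) :
  (forall k, measurable (F k)) -> trivIset setT F ->
  measurable_fun setT Z -> (forall w, 0 <= Z w) ->
  (forall k w, F k w -> Z w = c k) -> (forall k, P (F k) = p k) ->
  \sum_(k <oo) p k = 1 ->
  \int[P]_w Z w = \sum_(k <oo) c k * p k.
Proof.
move=> mF tF mZ Z0 Zc Fp p1.
have mU : measurable (\bigcup_k F k) by exact: bigcupT_measurable.
have PU : P (\bigcup_k F k) = 1.
  rewrite measure_bigcup// -p1.
  apply/congr_lim/funext => n; apply: eq_big => [k|k _]; last exact: Fp.
  by rewrite in_setT.
have PUC : P (~` \bigcup_k F k) = 0 by rewrite probability_setC// PU subee.
have mUC := measurableC mU.
rewrite (@ge0_negligible_integral _ _ _ _ setT (~` (\bigcup_k F k)))//.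
rewrite setTD setCK ge0_integral_bigcup//; last exact: measurable_funTS.
apply: eq_eseriesr => k _; rewrite -Fp.
have [->|F0] := eqVneq (F k) set0; first by rewrite integral_set0 measure0 mule0.
by rewrite -integral_cst//; apply: eq_integral => w; rewrite inE => /Zc ->.
Qed.

End discrete.

(** * Moments of the Poisson law *)

Section poisson_moments.
Local Open Scope ereal_scope.
Context (R : realType).
Implicit Type a : R.

Let p a k : R := (a ^+ k / k`!%:R * expR (- a))%R.

Let p_ge0 a k : (0 <= a)%R -> (0 <= p a k)%R.
Proof. by move=> a0; rewrite /p mulr_ge0 ?expR_ge0// divr_ge0// exprn_ge0. Qed.

Let pS a k : (k.+1%:R * p a k.+1 = a * p a k)%R.
Proof.
rewrite /p factS natrM exprS; field.
by rewrite nat1r !pnatr_eq0 -lt0n fact_gt0.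
Qed.

Lemma poisson_weight_sum a : (0 <= a)%R -> \sum_(k <oo) (p a k)%:E = 1.
Proof.
move=> a0; rewrite [RHS](_ : _ = (expR (- a))%:E * (expR a)%:E); last first.
  by rewrite -EFinM expRN mulVf ?gt_eqF ?expR_gt0.
under eq_eseriesr do rewrite /p EFinM muleC.
rewrite /= nneseriesZl/=; last first.
  by move=> n _; rewrite lee_fin divr_ge0// exprn_ge0.
congr *%E; rewrite expRE -EFin_lim; last first.
  rewrite /pseries/=; under eq_fun do rewrite mulrC.
  exact: is_cvg_series_exp_coeff.
apply/congr_lim/funext => n/=; rewrite /pseries/= /series/= -sumEFin//.
by under eq_bigr do rewrite mulrC.
Qed.

(** The Chen-Stein identity E[N f(N)] = a E[f(N + 1)]. Taking f constant, then f the identity,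
    yields the first two moments. *)
Let poisson_shift a (f : nat -> R) : (0 <= a)%R -> (forall k, (0 <= f k)%R) ->
  \sum_(k <oo) (k%:R * f k)%:E * (p a k)%:E =
  a%:E * \sum_(k <oo) (f k.+1)%:E * (p a k)%:E.
Proof.
move=> a0 f0; have pa k := p_ge0 k a0.
rewrite nneseries_recl//; last by move=> k _; rewrite mule_ge0// lee_fin// mulr_ge0.
rewrite mul0r mul0e add0e -nneseriesZl; last first.
  by move=> k _; rewrite mule_ge0// lee_fin.
rewrite -[in LHS](add0n 1%N) -nneseries_addn; last first.
  by move=> k; rewrite mule_ge0// lee_fin// mulr_ge0.
apply: eq_eseriesr => k _; rewrite !addn1 -!EFinM; congr EFin.
by rewrite mulrAC pS -mulrA [(p _ _ * _)%R]mulrC.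
Qed.

Lemma poisson_weight_mean a : (0 <= a)%R ->
  \sum_(k <oo) k%:R%:E * (p a k)%:E = a%:E.
Proof.
move=> a0; under eq_eseriesr do rewrite -[X in X%:E * _]mulr1.
rewrite (@poisson_shift a (fun=> 1%R))//.
under eq_eseriesr do rewrite mul1e.
by rewrite poisson_weight_sum// mule1.
Qed.

Lemma poisson_weight_second_moment a : (0 <= a)%R ->
  \sum_(k <oo) (k%:R ^+ 2)%:E * (p a k)%:E = (a ^+ 2 + a)%:E.
Proof.
move=> a0; under eq_eseriesr do rewrite expr2.
have pa k := p_ge0 k a0.
rewrite (@poisson_shift a (fun k => k%:R))//.
under eq_eseriesr do rewrite -natr1 EFinD ge0_muleDl ?lee_fin// mul1e.
rewrite nneseriesD; last 2 first.
- by move=> k _ _; rewrite mule_ge0// lee_fin.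
- by move=> k _ _; rewrite lee_fin.
rewrite poisson_weight_mean// poisson_weight_sum//.
by rewrite -EFinD -EFinM mulrDr mulr1.
Qed.

End poisson_moments.

(** * Poisson random measures and Campbell's formulas *)

Section independent_product.
Local Open Scope ereal_scope.
Context d (T : measurableType d) (R : realType) (P : probability T R).

(** The joint law agrees with the product of the marginal laws on rectangles, hence everywhere;
    Tonelli's theorem does the rest. *)
Lemma ge0_expectation_independent (Y Z : T -> \bar R) :
  measurable_fun setT Y -> measurable_fun setT Z ->
  (forall w, 0 <= Y w) -> (forall w, 0 <= Z w) ->
  (forall U V, measurable U -> measurable V ->
    P (Y @^-1` U `&` Z @^-1` V) = P (Y @^-1` U) * P (Z @^-1` V)) ->
  \int[P]_w (Y w * Z w) = \int[P]_w Y w * \int[P]_w Z w.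
Proof.
move=> mY mZ Y0 Z0 YZ.
pose Y' : {mfun T >-> \bar R} := HB.pack Y (isMeasurableFun.Build _ _ _ _ _ mY).
pose Z' : {mfun T >-> \bar R} := HB.pack Z (isMeasurableFun.Build _ _ _ _ _ mZ).
have mYZ : measurable_fun setT (fun w => (Y w, Z w)).
  exact: measurable_fun_pair.
pose YZ' : {mfun T >-> (\bar R * \bar R)%type} :=
  HB.pack (fun w => (Y w, Z w)) (isMeasurableFun.Build _ _ _ _ _ mYZ).
(* Absolute values make the integrand nonnegative on the whole plane, as Tonelli's theorem requires,
   without changing it on the range of [(Y, Z)]. *)
pose g (z : \bar R * \bar R) := `|z.1| * `|z.2|.
have mg : measurable_fun setT g.
  by apply: emeasurable_funM; apply: measurableT_comp.
have g0 z : 0 <= g z by rewrite mule_ge0.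
transitivity (\int[distribution P YZ']_z g z).
  rewrite ge0_integral_distribution//; apply: eq_integral => w _ /=.
  by rewrite /g/= !gee0_abs.
transitivity (\int[distribution P Y' \x distribution P Z']_z g z).
  apply: eq_measure_integral => A mA _; apply/esym.
  by apply: product_measure_unique => // U V mU mV; rewrite -[RHS]YZ.
rewrite fubini_tonelli1//= /fubini_F/= /g/=.
under eq_integral => y _.
  rewrite ge0_integralZl//=.
  rewrite ge0_integral_distribution//.
  under eq_integral => w _ do rewrite /= gee0_abs//.
  over.
rewrite /= ge0_integralZr//; last exact: integral_ge0.
rewrite ge0_integral_distribution//; congr (_ * _).
by apply: eq_integral => w _ /=; rewrite gee0_abs.
Qed.

End independent_product.

Section poisson_random_measure_moments.
Local Open Scope ereal_scope.
Context d d' (T : measurableType d) (E : measurableType d') (R : realType).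
Variables (P : probability T R) (K : T -> {measure set E -> \bar R}).
Variable la : {measure set E -> \bar R}.
Hypothesis HK : poisson_random_measure P (fun w A => K w A) la.

Let mK A : measurable A -> measurable_fun setT (K ^~ A).
Proof. exact: (prm_measurable HK). Qed.

Let mlevel A k : measurable A -> measurable [set w | K w A = k%:R%:E].
Proof.
move=> mA; rewrite -[X in measurable X]setTI.
by have := mK mA measurableT (emeasurable_set1 k%:R%:E); exact.
Qed.

(** [phi] must be nonnegative on all of [\bar R], which is why the moments below are computed with
    absolute values of counts. *)
Lemma prm_series (phi : \bar R -> \bar R) A : measurable A -> la A < +oo ->
  (forall x, 0 <= phi x) -> measurable_fun setT phi ->
  \int[P]_w phi (K w A) =
  \sum_(k <oo) phi k%:R%:E *
    (fine (la A) ^+ k / k`!%:R * expR (- fine (la A)))%:E.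
Proof.
move=> mA Aoo phi0 mphi.
apply: (@ge0_integral_partition _ _ _ P (fun k => [set w | K w A = k%:R%:E])) => //.
- by move=> k; exact: mlevel.
- apply/trivIsetP => i j _ _ ij; rewrite -subset0 => w [/= -> []].
  by move/eqP; rewrite eqr_nat (negbTE ij).
- by apply: measurableT_comp => //; exact: mK.
- by move=> k w /= ->.
- by move=> k; rewrite (prm_poisson HK).
- by rewrite poisson_weight_sum// fine_ge0.
Qed.

Lemma prm_mean A : measurable A -> \int[P]_w K w A = la A.
Proof.
move=> mA; have [Aoo|] := ltP (la A) +oo.
  under eq_integral do rewrite -[K _ _]gee0_abs//.
  rewrite (@prm_series abse)//.
  under eq_eseriesr do rewrite gee0_abs ?lee_fin//.
  by rewrite poisson_weight_mean ?fine_ge0// fineK// ge0_fin_numE.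
rewrite leye_eq => /eqP Aoo; rewrite Aoo.
transitivity (\int[P]_w cst +oo w).
  apply: ae_eq_integral => //; first exact: mK.
  by have := prm_infinite HK mA Aoo; apply: filterS => w ->.
by rewrite integral_cst//= probability_setT mule1.
Qed.

Lemma prm_second_moment A : measurable A -> la A < +oo ->
  \int[P]_w (K w A * K w A) = la A * la A + la A.
Proof.
move=> mA Aoo.
under eq_integral do rewrite -[K _ _]gee0_abs//.
rewrite (@prm_series (fun x => `|x| * `|x|))//; last first.
  by apply: emeasurable_funM; exact: abse_measurable.
under eq_eseriesr do rewrite gee0_abs ?lee_fin// -EFinM -expr2.
rewrite poisson_weight_second_moment ?fine_ge0//.
by rewrite EFinD expr2 EFinM fineK// ge0_fin_numE.
Qed.

Lemma prm_independent2 A B U V : measurable A -> measurable B ->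
  A `&` B = set0 -> measurable U -> measurable V ->
  P ((K ^~ A) @^-1` U `&` (K ^~ B) @^-1` V) =
  P ((K ^~ A) @^-1` U) * P ((K ^~ B) @^-1` V).
Proof.
move=> mA mB AB0 mU mV.
pose C (i : 'I_2) := if i == ord0 then A else B.
pose W (i : 'I_2) := if i == ord0 then U else V.
have := prm_independent HK (n := 2) (A := C).
rewrite /mutually_independent => /(_ _ _ W).
rewrite big_ord_recl big_ord1 /C /W /=; move=> <-.
- congr (P _); apply/seteqP; split => [w [/= UA VB] [[|[|//]] i2] _ //=|w UV].
  by split; [exact: (UV ord0)|exact: (UV ord_max)].
- by case=> [[|[|//]]].
- apply/trivIsetP => -[[|[|//]] i2] [[|[|//]] j2] _ _ //= _.
  by rewrite setIC.
- by case=> [[|[|//]]].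
Qed.

Lemma prm_mean_disjoint A B : measurable A -> measurable B ->
  A `&` B = set0 -> \int[P]_w (K w A * K w B) = la A * la B.
Proof.
move=> mA mB AB0; rewrite ge0_expectation_independent ?prm_mean//.
- exact: mK.
- exact: mK.
- by move=> U V mU mV; exact: prm_independent2.
Qed.

(** Split A and B along their intersection: disjoint pieces are independent, so only the common
    piece contributes a variance. Here [la A] may be infinite. *)
Lemma prm_covariance A B : measurable A -> measurable B -> la B < +oo ->
  \int[P]_w (K w B * K w A) = la B * la A + la (A `&` B).
Proof.
move=> mA mB Boo.
have mAB : measurable (A `&` B) by exact: measurableI.
have mAmB : measurable (A `\` B) by exact: measurableD.
have mBmA : measurable (B `\` A) by exact: measurableD.
have ABoo : la (A `&` B) < +oo.
  by rewrite (le_lt_trans _ Boo)// le_measure// inE.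
have AE (m : {measure set E -> \bar R}) : m A = m (A `\` B) + m (A `&` B).
  exact: measureDI.
have BE (m : {measure set E -> \bar R}) : m B = m (B `\` A) + m (A `&` B).
  by rewrite setIC; exact: measureDI.
under eq_integral do rewrite AE ge0_muleDr//.
rewrite ge0_integralD//=; first last.
- by apply: emeasurable_funM; exact: mK.
- by apply: emeasurable_funM; exact: mK.
rewrite prm_mean_disjoint//; last by rewrite setDE setICA setICr setI0.
rewrite [in la B * la A]AE ge0_muleDr// -addeA; congr (_ + _).
under eq_integral do rewrite BE ge0_muleDl//.
rewrite ge0_integralD//=; first last.
- by apply: emeasurable_funM; exact: mK.
- by apply: emeasurable_funM; exact: mK.
rewrite prm_mean_disjoint//; last by rewrite -subset0 => x [[_ Ax] [/Ax]].
by rewrite prm_second_moment// BE ge0_muleDl// addeA.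
Qed.

End poisson_random_measure_moments.

Section campbell.
Local Open Scope ereal_scope.
Context d d' (T : measurableType d) (E : measurableType d') (R : realType).
Variables (P : probability T R) (K : T -> {measure set E -> \bar R}).
Variable la : {measure set E -> \bar R}.
Hypothesis HK : poisson_random_measure P (fun w A => K w A) la.

Let mK A : measurable A -> measurable_fun setT (K ^~ A).
Proof. exact: (prm_measurable HK). Qed.

Let ge0_ae_fin (Y : T -> \bar R) : measurable_fun setT Y ->
  (forall w, 0 <= Y w) -> \int[P]_w Y w < +oo ->
  {ae P, forall w, Y w \is a fin_num}.
Proof.
move=> mY Y0 Yoo; have : P.-integrable setT Y.
  by apply/integrableP; split => //; under eq_integral do rewrite gee0_abs//.
by move/integrable_ae => /(_ measurableT); apply: filterS => w; exact.
Qed.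

Lemma measurable_prm_integral (h : E -> \bar R) :
  measurable_fun setT h -> (forall x, 0 <= h x) ->
  measurable_fun setT (fun w => \int[K w]_x h x).
Proof. by move=> mh h0; exact: measurable_fun_integral_kernel. Qed.

Lemma prm_integral_mean (h : E -> \bar R) :
  measurable_fun setT h -> (forall x, 0 <= h x) ->
  \int[P]_w \int[K w]_x h x = \int[la]_x h x.
Proof.
move=> mh h0; apply: integral_kernel_mean => // A mA.
by rewrite (prm_mean HK).
Qed.

Lemma prm_integral_fin_num (h : E -> \bar R) :
  measurable_fun setT h -> (forall x, 0 <= h x) -> \int[la]_x h x < +oo ->
  {ae P, forall w, \int[K w]_x h x \is a fin_num}.
Proof.
move=> mh h0 hoo; apply: ge0_ae_fin.
- exact: measurable_prm_integral.
- by move=> w; exact: integral_ge0.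
- by rewrite prm_integral_mean.
Qed.

(** The absence of points in C has probability exp(- la C) and is independent of the points outside
    C, where all of [h] lives. *)
Lemma prm_integral_void (C : set E) (h : E -> \bar R) :
  measurable C -> la C < +oo ->
  measurable_fun setT h -> (forall x, 0 <= h x) -> (forall x, C x -> h x = 0) ->
  \int[P]_w ((\1_[set w | K w C = 0] w)%:E * \int[K w]_x h x) =
  (expR (- fine (la C)))%:E * \int[la]_x h x.
Proof.
move=> mC Coo mh h0 hC.
have mlev : measurable [set w | K w C = 0].
  rewrite -[X in measurable X]setTI.
  by have := mK mC measurableT (emeasurable_set1 0%:E); exact.
have mCc : measurable (~` C) by exact: measurableC.
have [nu [nuE nuI]] := density_measure la (D := \1_(~` C))
  (measurable_indic mCc) (fun x => ler0n _ _).
pose e : {nonneg R} := NngNum (expR_ge0 (- fine (la C))).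
rewrite (@integral_mixture _ _ _ _ _ _ _ mK _ (mscale e nu))//; first last.
- move=> A mA.
  have mAC : measurable (A `\` C) by exact: measurableD.
  transitivity (\int[P]_w ((\1_[set w | K w C = 0] w)%:E * K w (A `\` C))).
    apply: eq_integral => w _; rewrite indicE.
    have [|_] := boolP (w \in _); last by rewrite !mul0e.
    rewrite inE /= => KC0; rewrite !mul1e (measureDI (K w) mA mC).
    rewrite [X in _ + X](_ : _ = 0) ?adde0//.
    by apply: (subset_measure0 _ mC) => //; exact: measurableI.
  (* Writing the indicator as a function of [K w C] exhibits its preimages as preimages under the
     count, to which [prm_independent2] applies. *)
  pose phi (x : \bar R) : \bar R := (\1_[set 0] x)%:E.
  have mphi : measurable_fun setT phi.
    by apply/measurable_EFinP; apply: measurable_indic; exact: emeasurable_set1.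
  transitivity (\int[P]_w (phi (K w C) * K w (A `\` C))).
    by apply: eq_integral => w _; rewrite /phi !indicE.
  have mY : measurable_fun setT (fun w => phi (K w C)).
    by apply: measurableT_comp => //; exact: mK.
  have ind U V : measurable U -> measurable V ->
      P ((fun w => phi (K w C)) @^-1` U `&` (K ^~ (A `\` C)) @^-1` V) =
      P ((fun w => phi (K w C)) @^-1` U) * P ((K ^~ (A `\` C)) @^-1` V).
    move=> mU mV; apply: (prm_independent2 HK (U := phi @^-1` U)) => //.
      by rewrite -subset0 => x [? []].
    by rewrite -[X in measurable X]setTI; exact: mphi.
  rewrite (ge0_expectation_independent mY (mK mAC))//; last first.
    by move=> w; rewrite /phi lee_fin.
  rewrite (prm_mean HK)//; transitivity (e%:num%:E * nu A); last by [].
  rewrite nuE//; congr (_ * _).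
    transitivity (\int[P]_w (\1_[set w | K w C = 0] w)%:E).
      by apply: eq_integral => w _; rewrite /phi !indicE.
    rewrite integral_indic// setIT.
    by have := prm_poisson HK mC Coo 0; rewrite expr0 fact0 divr1 mul1r.
  by rewrite integral_indic// setIC.
rewrite ge0_integral_mscale// nuI//; congr (_ * _); apply: eq_integral => x _.
rewrite indicE; have [|] := boolP (x \in _); first by rewrite mul1e.
rewrite notin_setE mul0e => /contrapT Cx; rewrite hC//.
Qed.


(** Weights in [integral_mixture] are real; passing an integrable weight through [fine] alters it on
    a null set only. *)
Let weight_fine (Y Z : T -> \bar R) : measurable_fun setT Y ->
  measurable_fun setT Z ->
  (forall w, 0 <= Y w) -> (forall w, 0 <= Z w) -> \int[P]_w Y w < +oo ->
  \int[P]_w ((fine (Y w))%:E * Z w) = \int[P]_w (Y w * Z w).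
Proof.
move=> mY mZ Y0 Z0 Yoo; apply: ge0_ae_eq_integral => //.
- apply: emeasurable_funM => //; apply/measurable_EFinP.
  exact: measurableT_comp.
- exact: emeasurable_funM.
- by move=> w _; rewrite mule_ge0// lee_fin fine_ge0.
- by move=> w _; rewrite mule_ge0.
- by have := ge0_ae_fin mY Y0 Yoo; apply: filterS => w Yw _; rewrite fineK.
Qed.

(** By [prm_covariance], weighting by [K w B] turns the mean measure into [la B] times [la] plus the
    restriction of [la] to B. *)
Lemma prm_integral_weight (B : set E) (h : E -> \bar R) :
  measurable B -> la B < +oo -> measurable_fun setT h -> (forall x, 0 <= h x) ->
  \int[P]_w (K w B * \int[K w]_x h x) =
  la B * \int[la]_x h x + \int[la]_(x in B) h x.
Proof.
move=> mB Boo mh h0; have mI := measurable_prm_integral mh h0.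
have [nu [nuE nuI]] := density_measure la (D := \1_B)
  (measurable_indic mB) (fun x => ler0n _ _).
pose b : {nonneg R} := NngNum (fine_ge0 (measure_ge0 la B)).
have bE : b%:num%:E = la B by rewrite /= fineK// ge0_fin_numE.
have KBoo : \int[P]_w K w B < +oo by rewrite (prm_mean HK).
rewrite -weight_fine//; [|exact: mK|by move=> w; exact: integral_ge0].
rewrite (@integral_mixture _ _ _ _ _ _ _ mK _ (measure_add (mscale b la) nu))//.
- rewrite ge0_integral_measure_add// ge0_integral_mscale// bE nuI//.
  congr (_ + _); rewrite [RHS]integral_mkcond; apply: eq_integral => x _.
  by rewrite indicE patchE; case: ifPn => _; rewrite ?mul1e ?mul0e.
- by apply: measurableT_comp => //; exact: mK.
- move=> A mA; rewrite weight_fine//; [|exact: mK|exact: mK].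
  rewrite (prm_covariance HK)// [RHS](measure_addE (mscale b la) nu A) /mscale.
  rewrite [X in _ = X * _ + _]bE nuE//; congr (_ + _).
  by rewrite integral_indic// setIC.
Qed.

(** The previous lemma, with the roles of set and function exchanged, identifies the mean measure
    under the weight given by the integral of [h]: a multiple of [la] plus the measure of density
    [h]. Integrating [h] against it gives the claim. *)
Lemma prm_integral_second_moment (h : E -> R) :
  measurable_fun setT h -> (forall x, (0 <= h x)%R) ->
  \int[la]_x (h x)%:E < +oo ->
  \int[P]_w (\int[K w]_x (h x)%:E * \int[K w]_x (h x)%:E) =
  \int[la]_x (h x)%:E * \int[la]_x (h x)%:E + \int[la]_x (h x ^+ 2)%:E.
Proof.
move=> mh h0 hoo; have mhE : measurable_fun setT (EFin \o h).
  exact/measurable_EFinP.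
have h0E x : 0 <= (EFin \o h) x by rewrite lee_fin.
have mI := measurable_prm_integral mhE h0E.
have I0 w : 0 <= \int[K w]_x (h x)%:E by apply: integral_ge0 => x _; exact: h0E.
have la0 : 0 <= \int[la]_x (h x)%:E by apply: integral_ge0 => x _; exact: h0E.
have Ioo : \int[P]_w \int[K w]_x (h x)%:E < +oo by rewrite (prm_integral_mean mhE h0E).
have [nu [nuE nuI]] := density_measure la mh h0.
pose c : {nonneg R} := NngNum (fine_ge0 la0).
have cE : c%:num%:E = \int[la]_x (h x)%:E by rewrite /= fineK// ge0_fin_numE.
rewrite -weight_fine//.
rewrite (@integral_mixture _ _ _ _ _ _ _ mK _ (measure_add (mscale c la) nu))//.
- rewrite (@ge0_integral_measure_add _ _ _ _ _ setT measurableT _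
    (fun x _ => h0E x) mhE).
  rewrite (@ge0_integral_mscale _ _ _ _ setT measurableT c _ mhE
    (fun x _ => h0E x)).
  rewrite cE (nuI _ mhE h0E).
  by congr (_ + _); apply: eq_integral => x _; rewrite -EFinM expr2.
- exact: measurableT_comp.
- by move=> w; exact: fine_ge0.
- move=> A mA; rewrite weight_fine//; [|exact: mK].
  rewrite [RHS](measure_addE (mscale c la) nu A) /mscale.
  rewrite [X in _ = X * _ + _]cE nuE//.
  have [Aoo|] := ltP (la A) +oo.
    rewrite (eq_integral (fun w => K w A * \int[K w]_x (h x)%:E)); last first.
      by move=> w _; rewrite muleC.
    by rewrite (prm_integral_weight mA Aoo mhE h0E) muleC.
  (* Sets of infinite intensity have infinite count almost surely. Both sides are then +oo, or 0 if
     the integral of [h] vanishes. *)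
  rewrite leye_eq => /eqP Aoo; rewrite Aoo.
  transitivity (\int[P]_w (\int[K w]_x (h x)%:E * +oo)).
    apply: ae_eq_integral => //.
    + by apply: emeasurable_funM => //; exact: mK.
    + exact: emeasurable_funM.
    + by have := prm_infinite HK mA Aoo; apply: filterS => w ->.
  rewrite ge0_integralZr// (prm_integral_mean mhE h0E)//.
  have : 0 <= \int[la]_(x in A) (h x)%:E by apply: integral_ge0 => x _; exact: h0E.
  have : \int[la]_(x in A) (h x)%:E <= \int[la]_x (h x)%:E.
    by apply: ge0_subset_integral => // x _; exact: h0E.
  have := la0; rewrite le_eqVlt => /predU1P[<-|lagt0].
    rewrite mul0e => a b; have /eqP -> : \int[la]_(x in A) (h x)%:E == 0.
      by rewrite eq_le a b.
    by rewrite adde0.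
  by move=> _ a; rewrite gt0_muley// addye// -ltNye (lt_le_trans _ a).
Qed.

End campbell.

(** * The jumps up to a fixed time *)

Section jumps_upto.
Local Open Scope ereal_scope.
Context {R : realType}.
Implicit Types (x : R -> R) (t : R).

Definition jumps_upto x t (A : set R) : \bar R :=
  jump_measure x (A `*` `]0%R, t]).

Section jumps_upto_measure.
Variables (x : R -> R) (t : R).

Let jumps_upto0 : jumps_upto x t set0 = 0.
Proof. by rewrite /jumps_upto set0X measure0. Qed.

Let jumps_upto_ge0 A : 0 <= jumps_upto x t A.
Proof. exact: measure_ge0. Qed.

Let jumps_upto_sigma_additive : semi_sigma_additive (jumps_upto x t).
Proof.
move=> F mF tF mUF; rewrite /jumps_upto setX_bigcupl.
apply: measure_semi_sigma_additive.
- by move=> n; exact: measurableX.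
- apply/trivIsetP => i j _ _ ij; rewrite -setXI.
  by move/trivIsetP : tF => ->//; rewrite set0X.
- by rewrite -setX_bigcupl; exact: measurableX.
Qed.

HB.instance Definition _ := isMeasure.Build _ _ _ (jumps_upto x t)
  jumps_upto0 jumps_upto_ge0 jumps_upto_sigma_additive.

End jumps_upto_measure.

(* [jumps_upto x t] is the mixture of the Dirac masses at [z.1] with weight
   [z.2 <= t], for [z] distributed as the jump measure. *)
Lemma ge0_integral_jumps_upto x t (D : set R) (g : R -> \bar R) :
  measurable D -> measurable_fun setT g -> (forall y, 0 <= g y) ->
  \int[jump_measure x]_(z in D `*` `]0%R, t]) g z.1 =
  \int[jumps_upto x t]_(y in D) g y.
Proof.
move=> mD mg g0.
pose K (z : R * R) : {measure set R -> \bar R} := \d_(z.1).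
have mK A : measurable A -> measurable_fun setT (K ^~ A).
  move=> mA; rewrite (_ : K ^~ A = EFin \o ((\1_A : R -> R) \o fst))//.
  by apply/measurable_EFinP; apply: measurableT_comp.
pose w (z : R * R) : R := \1_(setT `*` `]0%R, t]) z.
have mw : measurable_fun setT w by apply: measurable_indic; exact: measurableX.
have w0 z : (0 <= w z)%R by [].
have KE A : measurable A ->
    \int[jump_measure x]_z ((w z)%:E * K z A) = jumps_upto x t A.
  move=> mA; rewrite /jumps_upto -[A `*` _]setIT -integral_indic//; last first.
    exact: measurableX.
  apply: eq_integral => z _; rewrite [K z A]diracE /w !indicE -EFinM -natrM mulnb.
  by congr (_%:R%:E); rewrite !in_setX in_setT andbC.
have mgD : measurable_fun setT (g \_ D).
  by apply/(measurable_restrictT _ mD); exact: measurable_funTS.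
rewrite [RHS]integral_mkcond -(integral_mixture mK mw w0 KE mgD); last first.
  by move=> y; rewrite patchE; case: ifPn.
rewrite [LHS]integral_mkcond; apply: eq_integral => z _.
rewrite integral_dirac// diracT mul1e !patchE /w indicE !in_setX in_setT/=.
by case: (z.1 \in D) => /=; case: (_ \in _); rewrite ?mul1e ?mul0e ?mule0.
Qed.

Lemma integral_jumps_upto x t (D : set R) (g : R -> R) :
  measurable D -> measurable_fun setT g ->
  \int[jump_measure x]_(z in D `*` `]0%R, t]) (g z.1)%:E =
  \int[jumps_upto x t]_(y in D) (g y)%:E.
Proof.
move=> mD mg; have mgE : measurable_fun setT (EFin \o g) by exact/measurable_EFinP.
rewrite integralE [RHS]integralE; congr (_ - _).
- transitivity (\int[jump_measure x]_(z in D `*` `]0%R, t]) (EFin \o g)^\+ z.1).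
    by apply: eq_integral => z _; rewrite !funeposE.
  by rewrite (ge0_integral_jumps_upto _ _ mD (measurable_funepos mgE)).
- transitivity (\int[jump_measure x]_(z in D `*` `]0%R, t]) (EFin \o g)^\- z.1).
    by apply: eq_integral => z _; rewrite !funenegE.
  by rewrite (ge0_integral_jumps_upto _ _ mD (measurable_funeneg mgE)).
Qed.

Lemma prm_jumps_upto d (T : measurableType d) (P : probability T R)
    (X : R -> T -> R) (F : {measure set R -> \bar R}) t (t0 : (0 <= t)%R) :
  poisson_random_measure P (fun w => jump_measure (X ^~ w)) (jump_intensity F) ->
  poisson_random_measure P (fun w A => jumps_upto (X ^~ w) t A)
    (mscale (NngNum t0) F).
Proof.
move=> HN.
have mX (A : set R) : measurable A -> measurable (A `*` `]0%R, t]).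
  by move=> mA; exact: measurableX.
have laE A : measurable A ->
    jump_intensity F (A `*` `]0%R, t]) = mscale (NngNum t0) F A.
  move=> mA; rewrite /jump_intensity (_ : _ `&` _ = A `*` `]0%R, t]).
    rewrite product_measure1E//= lebesgue_measure_itv/= lte_fin.
    rewrite /mscale/= muleC.
    move: t0; rewrite le_eqVlt => /predU1P[<-|->]; first by rewrite ltxx.
    by rewrite sube0.
  rewrite -setXI setIT; congr (_ `*` _); apply: setIidl => s /=.
  by rewrite !in_itv/= => /andP[-> _].
split.
- by move=> A mA; exact: (prm_measurable HN (mX _ mA)).
- by move=> A mA; rewrite -laE// => Aoo k; rewrite -(prm_poisson HN)//; exact: mX.
- by move=> A mA; rewrite -laE// => Aoo; exact: (prm_infinite HN (mX _ mA) Aoo).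
- move=> n A mA tA; apply: (prm_independent HN); first by move=> i; exact: mX.
  apply/trivIsetP => i j _ _ ij; rewrite -setXI.
  by move/trivIsetP : tA => ->//; rewrite set0X.
Qed.

End jumps_upto.

(** * Truncation and deviation bounds *)

Section second_moment_tools.
Local Open Scope ereal_scope.
Context d (T : measurableType d) (R : realType) (P : probability T R).

Lemma chebyshev_second_moment (Y : T -> R) (c : R) :
  measurable_fun setT Y -> (0 < c)%R ->
  P [set w | (c <= `|Y w|)%R] <= (c ^- 2)%:E * \int[P]_w (Y w ^+ 2)%:E.
Proof.
move=> mY c0; rewrite lee_pdivlMl ?exprn_gt0//.
have mA : measurable [set w | (c <= `|Y w|)%R].
  by apply: measurable_set_le => //; exact: measurableT_comp.
have mY2 : measurable_fun setT (fun w => (Y w ^+ 2)%:E).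
  by apply/measurable_EFinP; exact: measurable_funX.
have Y20 w : 0 <= (Y w ^+ 2)%:E by rewrite lee_fin sqr_ge0.
rewrite -integral_cst//.
apply: (@le_trans _ _ (\int[P]_(w in [set w | (c <= `|Y w|)%R]) (Y w ^+ 2)%:E)).
  apply: ge0_le_integral => //.
  - by move=> w _; rewrite lee_fin exprn_ge0// ltW.
  - exact: measurable_funTS.
  - move=> w /= cY; rewrite lee_fin -(real_normK (num_real (Y w))).
    by rewrite lerXn2r// nnegrE ltW// (lt_le_trans c0).
by apply: ge0_subset_integral.
Qed.

Lemma second_momentD (Y Z : T -> R) :
  measurable_fun setT Y -> measurable_fun setT Z ->
  \int[P]_w ((Y w + Z w) ^+ 2)%:E <=
  2%:E * \int[P]_w (Y w ^+ 2)%:E + 2%:E * \int[P]_w (Z w ^+ 2)%:E.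
Proof.
move=> mY mZ.
have mY2 : measurable_fun setT (fun w => (Y w ^+ 2)%:E).
  by apply/measurable_EFinP; exact: measurable_funX.
have mZ2 : measurable_fun setT (fun w => (Z w ^+ 2)%:E).
  by apply/measurable_EFinP; exact: measurable_funX.
have Y20 w : 0 <= (Y w ^+ 2)%:E by rewrite lee_fin sqr_ge0.
have Z20 w : 0 <= (Z w ^+ 2)%:E by rewrite lee_fin sqr_ge0.
rewrite -!ge0_integralZl//.
rewrite -ge0_integralD//; last 4 first.
- by move=> w _; rewrite mule_ge0.
- exact: measurable_funeM.
- by move=> w _; rewrite mule_ge0.
- exact: measurable_funeM.
apply: ge0_le_integral => //.
- by move=> w _; rewrite lee_fin sqr_ge0.
- by apply/measurable_EFinP; apply: measurable_funX; exact: measurable_funD.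
- by apply: emeasurable_funD; exact: measurable_funeM.
- move=> w _; rewrite -!EFinM -EFinD lee_fin; have := sqr_ge0 (Y w - Z w)%R; lra.
Qed.

End second_moment_tools.

Section variance.
Local Open Scope ereal_scope.
Context d d' (T : measurableType d) (E : measurableType d') (R : realType).
Variables (P : probability T R) (K : T -> {measure set E -> \bar R}).
Variable la : {measure set E -> \bar R}.
Hypothesis HK : poisson_random_measure P (fun w A => K w A) la.

Lemma measurable_fine_prm_integral (h : E -> R) :
  measurable_fun setT h -> (forall x, (0 <= h x)%R) ->
  measurable_fun setT (fun w => fine (\int[K w]_x (h x)%:E)).
Proof.
move=> mh h0; apply: measurableT_comp => //.
apply: (measurable_prm_integral HK); first exact/measurable_EFinP.
by move=> x; rewrite lee_fin.
Qed.

Lemma prm_integral_variance (h : E -> R) (a : R) :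
  measurable_fun setT h -> (forall x, (0 <= h x)%R) ->
  \int[la]_x (h x)%:E = a%:E ->
  \int[P]_w ((fine (\int[K w]_x (h x)%:E) - a) ^+ 2)%:E =
  \int[la]_x (h x ^+ 2)%:E.
Proof.
move=> mh h0 ha.
have mZ := measurable_fine_prm_integral mh h0.
set Z := fun w => _ in mZ.
have mhE : measurable_fun setT (EFin \o h) by exact/measurable_EFinP.
have h0E x : 0 <= (EFin \o h) x by rewrite lee_fin.
have a0 : (0 <= a)%R.
  by rewrite -lee_fin -ha; apply: integral_ge0 => x _; exact: h0E.
have Zfin : {ae P, forall w, (Z w)%:E = \int[K w]_x (h x)%:E}.
  have := prm_integral_fin_num HK mhE h0E.
  by rewrite ha ltry => /(_ isT); apply: filterS => w ?; rewrite fineK.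
have Z0 w : (0 <= Z w)%R.
  by rewrite fine_ge0// integral_ge0// => x _; exact: h0E.
have mI := measurable_prm_integral HK mhE h0E.
have EZ : \int[P]_w (Z w)%:E = a%:E.
  rewrite -ha -(prm_integral_mean HK mhE h0E).
  apply: ae_eq_integral => //; first exact/measurable_EFinP.
  by apply: filterS Zfin => w.
have EZ2 : \int[P]_w (Z w ^+ 2)%:E = (a ^+ 2)%:E + \int[la]_x (h x ^+ 2)%:E.
  transitivity (\int[P]_w (\int[K w]_x (h x)%:E * \int[K w]_x (h x)%:E)).
    apply: ae_eq_integral => //.
    - by apply/measurable_EFinP; exact: measurable_funX.
    - exact: emeasurable_funM.
    - by apply: filterS Zfin => w Zw _; rewrite expr2 EFinM Zw.
  by rewrite (prm_integral_second_moment HK)// ha// ltry.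
(* Adding 2 a^2, the mean of 2 a Z, to both sides keeps all integrands nonnegative: (Z - a)^2 + 2 a
   Z = Z^2 + a^2. *)
suff : \int[P]_w ((Z w - a) ^+ 2)%:E + (2 * a ^+ 2)%:E =
    \int[la]_x (h x ^+ 2)%:E + (2 * a ^+ 2)%:E.
  by move/(congr1 (fun x => x - (2 * a ^+ 2)%:E)); rewrite !addeK.
have aZ : (2 * a ^+ 2)%:E = \int[P]_w ((2 * a)%:E * (Z w)%:E).
  rewrite ge0_integralZl//.
  - by rewrite EZ -EFinM -mulrA expr2.
  - exact/measurable_EFinP.
  - by move=> w _; rewrite lee_fin.
  - by rewrite lee_fin mulr_ge0.
rewrite [in LHS]aZ -ge0_integralD//; last 4 first.
- by move=> w _; rewrite lee_fin sqr_ge0.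
- by apply/measurable_EFinP; apply: measurable_funX; exact: measurable_funB.
- by move=> w _; rewrite -EFinM lee_fin !mulr_ge0.
- by apply: measurable_funeM; exact/measurable_EFinP.
transitivity (\int[P]_w ((Z w ^+ 2)%:E + (a ^+ 2)%:E)).
  by apply: eq_integral => w _; rewrite -EFinM -!EFinD; congr EFin; ring.
rewrite ge0_integralD//; last 3 first.
- by move=> w _; rewrite lee_fin sqr_ge0.
- by apply/measurable_EFinP; exact: measurable_funX.
- by move=> w _; rewrite lee_fin sqr_ge0.
rewrite EZ2 integral_cst//= probability_setT mule1 addeAC addeC -EFinD.
by congr (_ + _%:E); ring.
Qed.

End variance.

(** * Sums over geometric scales *)

Section geometric_scale.
Context (R : realType).
Implicit Types q u e : R.

Lemma sum_pow_below q u n : 1 < q -> 0 <= u ->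
  \sum_(k < n) q ^+ k * (q ^+ k < u)%R%:R <= q / (q - 1) * u.
Proof.
move=> q1 u0; have q10 : 0 < q - 1 by rewrite subr_gt0.
have q0 : 0 < q by exact: lt_trans q1.
(* The second bound carries the induction: while q^n < u, the sum through n is at most q^(n+1) / (q
   - 1), hence below the first bound. *)
suff [] : \sum_(k < n) q ^+ k * (q ^+ k < u)%R%:R <= q / (q - 1) * u /\
    \sum_(k < n) q ^+ k * (q ^+ k < u)%R%:R <= q ^+ n / (q - 1) by [].
elim: n => [|n [IH1 IH2]].
  rewrite big_ord0 expr0; split; last by rewrite divr_ge0// ltW.
  by rewrite mulr_ge0// divr_ge0// ltW.
have step : q ^+ n / (q - 1) + q ^+ n = q ^+ n.+1 / (q - 1).
  by rewrite exprS; field; rewrite gt_eqF.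
rewrite big_ord_recr/=; case: ltP => qu.
  rewrite mulr1; have H : \sum_(k < n) q ^+ k * (q ^+ k < u)%R%:R + q ^+ n <=
    q ^+ n.+1 / (q - 1) by rewrite -step lerD2r.
  split => //; rewrite (le_trans H)// exprS mulrAC ler_wpM2l// ?ltW//.
  by rewrite divr_gt0.
rewrite mulr0 addr0; split => //; rewrite (le_trans IH2)// -step lerDl.
by rewrite exprn_ge0// ltW.
Qed.

Lemma sum_pow_above q u n : 1 < q -> 0 <= u ->
  \sum_(k < n) u ^+ 2 / q ^+ k * (u <= q ^+ k)%R%:R <= q / (q - 1) * u.
Proof.
move=> q1; rewrite le_eqVlt => /predU1P[<-|u0].
  rewrite mulr0 big1// => k _; by rewrite expr0n/= !mul0r.
have q10 : 0 < q - 1 by rewrite subr_gt0.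
have q0 : 0 < q by exact: lt_trans q1.
pose S m := \sum_(k < m) (u <= q ^+ k)%R%:R / q ^+ k.
(* The term q^-n stands for the rest of the geometric series: since (q - 1)/q q^-n + q^-(n+1) =
   q^-n, the left side is constant once u <= q^n, and at the first such scale it is q^-n <= 1/u. *)
have [H1 H2] : (u <= q ^+ n -> (q - 1) / q * S n + (q ^+ n)^-1 <= u^-1) /\
    (q ^+ n < u -> S n = 0).
  rewrite /S; elim: n => [|n [IH1 IH2]].
    rewrite !big_ord0 expr0 mulr0 add0r invr1; split => // u1.
    by rewrite -[leLHS]invr1 lef_pV2// posrE.
  rewrite big_ord_recr/=; split => [uq|qu].
    have [un|nu] := leP u (q ^+ n).
      rewrite (le_trans _ (IH1 un))// mul1r mulrDr -addrA lerD2l.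
      rewrite exprS invfM le_eqVlt; apply/orP; left; apply/eqP; field.
      by rewrite !gt_eqF// exprn_gt0.
    rewrite IH2// mul0r !add0r mulr0 add0r lef_pV2// posrE exprn_gt0//.
  have nu : q ^+ n < u.
    by rewrite (le_lt_trans _ qu)// exprS ler_peMl ?exprn_ge0 ?ltW.
  by rewrite IH2// leNgt nu mul0r addr0.
have -> : \sum_(k < n) u ^+ 2 / q ^+ k * (u <= q ^+ k)%R%:R = u ^+ 2 * S n.
  by rewrite /S mulr_sumr; apply: eq_bigr => k _; rewrite -mulrA [_^-1 * _]mulrC.
have [uq|qu] := leP u (q ^+ n); last first.
  by rewrite H2// mulr0 mulr_ge0// ?ltW// divr_gt0.
have {}H1 : (q - 1) / q * S n <= u^-1.
  by rewrite (le_trans _ (H1 uq))// lerDl invr_ge0 exprn_ge0// ltW.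
have -> : u ^+ 2 * S n = q / (q - 1) * (u ^+ 2 * ((q - 1) / q * S n)).
  by field; rewrite !gt_eqF.
rewrite ler_wpM2l//; first by rewrite divr_ge0// ltW.
rewrite (le_trans (ler_wpM2l _ H1)) ?sqr_ge0// expr2 -mulrA divff ?mulr1//.
by rewrite gt_eqF.
Qed.

End geometric_scale.

(** The price of truncating at level [a] over a time at most [a], per jump of size [u]. The first
    term bounds the probability that a jump exceeds [a]; the second is Chebyshev's bound for the
    other jumps with threshold e a / 2, whence 4 / e^2. *)
Definition truncation_cost (R : realType) (e a u : R) : R :=
  a * (a < u)%R%:R + 4 / e ^+ 2 * (u ^+ 2 / a * (u <= a)%R%:R).

Lemma truncation_cost_ge0 (R : realType) (e a u : R) :
  0 <= a -> 0 <= truncation_cost e a u.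
Proof.
move=> a0; apply: addr_ge0; first exact: mulr_ge0.
apply: mulr_ge0; first by rewrite divr_ge0 ?sqr_ge0.
by rewrite mulr_ge0// divr_ge0 ?sqr_ge0.
Qed.

Section deviation.
Local Open Scope ereal_scope.
Context d d' (T : measurableType d) (E : measurableType d') (R : realType).
Variables (P : probability T R) (F : {measure set E -> \bar R}).
Variables (g : E -> R) (m : R).
Hypothesis mg : measurable_fun setT g.
Hypothesis g0 : forall x, (0 <= g x)%R.
Hypothesis gm : \int[F]_x (g x)%:E = m%:E.

Let mgE : measurable_fun setT (EFin \o g).
Proof. exact/measurable_EFinP. Qed.

Let m0 : (0 <= m)%R.
Proof. by rewrite -lee_fin -gm integral_ge0// => x _; rewrite lee_fin. Qed.

Let mlt (a : R) : measurable [set x | (a < g x)%R].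
Proof. exact: measurable_set_lt. Qed.

Let mle (a : R) : measurable [set x | (g x <= a)%R].
Proof. exact: measurable_set_le. Qed.

Lemma measurable_truncation_cost e a :
  measurable_fun setT (fun x => truncation_cost e a (g x)).
Proof.
apply: measurable_funD; apply: measurable_funM => //.
  rewrite (_ : (fun x => _) = \1_[set x | (a < g x)%R] :> (E -> R)).
    exact: measurable_indic.
  by apply/funext => x; rewrite indicE; congr _%:R; rewrite mem_setE.
apply: measurable_funM.
  by apply: measurable_funM => //; exact: measurable_funX.
rewrite (_ : (fun x => _) = \1_[set x | (g x <= a)%R] :> (E -> R)).
  exact: measurable_indic.
by apply/funext => x; rewrite indicE; congr _%:R; rewrite mem_setE.
Qed.

(** Half of the allowed deviation e a pays for the mean lost by truncation, the other half is left
    to Chebyshev's inequality. If no point exceeds [a], truncation does not change the random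
    integral. *)
Lemma prm_deviation (K : T -> {measure set E -> \bar R}) (s : {nonneg R}) (e a : R) :
  poisson_random_measure P (fun w A => K w A) (mscale s F) ->
  (0 < e)%R -> (0 < a)%R -> (s%:num <= a)%R ->
  \int[F]_(x in [set x | (a < g x)%R]) (g x)%:E <= (e / 2)%:E ->
  P [set w | (e * a < `|fine (\int[K w]_x (g x)%:E) - s%:num * m|)%R] <=
  \int[F]_x (truncation_cost e a (g x))%:E.
Proof.
move=> HK e0 a0 sa tail.
pose B := [set x | (a < g x)%R].
pose h x := (g x * \1_(~` B) x)%R.
have mB : measurable B := mlt a.
have mh : measurable_fun setT h.
  by apply: measurable_funM => //; apply: measurable_indic; exact: measurableC.
have h0 x : (0 <= h x)%R by rewrite mulr_ge0.
have mhE : measurable_fun setT (EFin \o h) by exact/measurable_EFinP.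
have gh : m%:E = \int[F]_x (h x)%:E + \int[F]_(x in B) (g x)%:E.
  rewrite -gm [X in _ = _ + X]integral_mkcond -ge0_integralD//; first last.
  - by apply/(measurable_restrictT _ mB); exact: measurable_funTS.
  - by move=> x _; rewrite patchE; case: ifPn => // _; rewrite lee_fin.
  - by move=> x _; rewrite lee_fin.
  apply: eq_integral => x _; rewrite patchE /h indicE in_setC.
  by case: (x \in B) => /=; rewrite ?mulr0 ?mulr1 ?add0e ?adde0.
(* Markov's inequality; finiteness is needed for the Poisson law of [K w B]. *)
have Foo : F B < +oo.
  have : a%:E * F B <= m%:E.
    rewrite -integral_cst//= -gm; apply: (@le_trans _ _ (\int[F]_(x in B) (g x)%:E)).
      apply: ge0_le_integral => //.
      + by move=> x _; rewrite lee_fin ltW.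
      + exact: measurable_funTS.
      + by move=> x ax; rewrite lee_fin ltW.
    by apply: ge0_subset_integral => // x _; rewrite lee_fin.
  case: (F B) (measure_ge0 F B) => [r||]//; first by rewrite ltry.
  by rewrite gt0_muley ?lte_fin// leye_eq.
have hoo : \int[F]_x (h x)%:E < +oo.
  rewrite (@le_lt_trans _ _ m%:E) ?ltry// gh leeDl//.
  by apply: integral_ge0 => x _; rewrite lee_fin.
pose mh' := fine (\int[F]_x (h x)%:E).
have mh'E : \int[F]_x (h x)%:E = mh'%:E.
  rewrite fineK// ge0_fin_numE// integral_ge0// => x _; by rewrite lee_fin.
have lah : \int[mscale s F]_x (h x)%:E = (s%:num * mh')%:E.
  by rewrite ge0_integral_mscale// ?mh'E// => x _; rewrite lee_fin.
have mhm : (`|s%:num * mh' - s%:num * m| <= a * (e / 2))%R.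
  have mm : (mh' <= m)%R.
    rewrite -lee_fin gh mh'E leeDl//.
    by apply: integral_ge0 => x _; rewrite lee_fin.
  have : m%:E <= mh'%:E + (e / 2)%:E by rewrite gh mh'E leeD2l.
  rewrite -EFinD lee_fin => mm2.
  rewrite -mulrBr normrM ger0_norm// ler0_norm ?subr_le0// opprB.
  by apply: ler_pM => //; [rewrite subr_ge0|lra].
have mZ := measurable_fine_prm_integral HK mh h0.
pose dev := [set w | (e * a / 2 <= `|fine (\int[K w]_x (h x)%:E) - s%:num * mh'|)%R].
pose hit := [set w | K w B != 0].
have mdev : measurable dev.
  by apply: measurable_set_le => //; apply: measurableT_comp => //; exact: measurable_funB.
have mhit : measurable hit.
  rewrite -[X in measurable X]setTI.
  by apply: measurable_neqe => //; exact: (prm_measurable HK).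
(* 1 - exp(-x) <= x with x = s F(B), and s <= a. *)
have Phit : P hit <= a%:E * F B.
  have laB : (fine (s%:num%:E * F B))%:E = s%:num%:E * F B.
    by rewrite fineK// ge0_fin_numE ?mule_ge0// lte_mul_pinfty.
  rewrite (_ : hit = ~` [set w | K w B = 0]); last first.
    by apply/seteqP; split => w /= /eqP.
  rewrite probability_setC; last first.
    rewrite -[X in measurable X]setTI.
    by have := prm_measurable HK mB measurableT (emeasurable_set1 0%:E); exact.
  have /= := prm_poisson HK mB _ 0.
  rewrite /mscale/= expr0 fact0 divr1 mul1r => ->; last exact: lte_mul_pinfty.
  apply: (@le_trans _ _ (s%:num%:E * F B)); last by rewrite lee_wpmul2r// lee_fin.
  rewrite -laB -EFinB lee_fin; have := expR_ge1Dx (- fine (s%:num%:E * F B)).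
  lra.
have Pdev : P dev <= (4 / (e ^+ 2 * a))%:E * \int[F]_x (h x ^+ 2)%:E.
  have ea : (0 < e * a / 2)%R by rewrite !mulr_gt0.
  apply: (le_trans (chebyshev_second_moment P _ ea)).
    exact: measurable_funB.
  rewrite (prm_integral_variance HK mh h0 lah) ge0_integral_mscale//; last 2 first.
  - by apply/measurable_EFinP; exact: measurable_funX.
  - by move=> x _; rewrite lee_fin sqr_ge0.
  rewrite muleA -EFinM lee_wpmul2r//.
    by apply: integral_ge0 => x _; rewrite lee_fin sqr_ge0.
  rewrite lee_fin (_ : 4 / (e ^+ 2 * a) = (e * a / 2) ^- 2 * a)%R.
    by rewrite ler_wpM2l// invr_ge0 sqr_ge0.
  by field; rewrite !gt_eqF.
apply: (@le_trans _ _ (P (hit `|` dev))).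
  apply: le_measure; rewrite ?inE.
  - apply: measurable_set_lt => //; apply: measurableT_comp => //.
    by apply: measurable_funB => //; exact: (measurable_fine_prm_integral HK).
  - exact: measurableU.
  move=> w /= dw; have [KB|KB] := eqVneq (K w B) 0; [right|by left].
  have gE : \int[K w]_x (g x)%:E = \int[K w]_x (h x)%:E.
    rewrite (ge0_negligible_integral mB)//; last by move=> x _; rewrite lee_fin.
    rewrite setTD.
    rewrite [LHS]integral_mkcond; apply: eq_integral => x _.
    rewrite patchE /h indicE.
    by case: ifPn => _; rewrite ?mulr1 ?mulr0.
  rewrite /dev/=; move: dw; rewrite gE; set Z := fine _ => dw.
  have := ler_distD (s%:num * mh')%R Z (s%:num * m)%R.
  move: dw mhm; lra.
apply: (le_trans (measureU2 _ mhit mdev)).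
apply: (le_trans (leeD Phit Pdev)).
rewrite -[X in a%:E * F X]setIT -integral_indic//.
have mB1 : measurable_fun setT (EFin \o (\1_B : E -> R)).
  by apply/measurable_EFinP; exact: measurable_indic.
have mh2 : measurable_fun setT (fun x => (h x ^+ 2)%:E).
  by apply/measurable_EFinP; exact: measurable_funX.
have c0 : (0 <= 4 / (e ^+ 2 * a))%R by rewrite divr_ge0// mulr_ge0 ?sqr_ge0// ltW.
rewrite -ge0_integralZl//; last by rewrite lee_fin ltW.
rewrite -ge0_integralZl//; [|by move=> x _; rewrite lee_fin sqr_ge0].
rewrite -ge0_integralD//; last 4 first.
- by move=> x _; rewrite mule_ge0// lee_fin// ltW.
- exact: measurable_funeM.
- by move=> x _; rewrite mule_ge0// lee_fin// sqr_ge0.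
- exact: measurable_funeM.
rewrite le_eqVlt; apply/orP; left; apply/eqP; apply: eq_integral => x _.
rewrite -!EFinM -EFinD /truncation_cost /h !indicE in_setC leNgt; congr EFin.
have -> : (x \in B) = (a < g x)%R by apply/idP/idP; rewrite inE.
case: (a < g x)%R => /=; rewrite ?mulr0 ?mulr1 ?expr0n/= ?mulr0 ?add0r//.
by field; rewrite !gt_eqF.
Qed.

End deviation.

Lemma pow_unbounded (R : realType) (q u : R) : 1 < q -> exists k, u <= q ^+ k.
Proof.
move=> q1; have q10 : 0 < q - 1 by rewrite subr_gt0.
have bern k : 1 + k%:R * (q - 1) <= q ^+ k.
  elim: k => [|k IH]; first by rewrite mul0r addr0 expr0.
  rewrite exprS; apply: (@le_trans _ _ (q * (1 + k%:R * (q - 1)))).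
    rewrite -natr1; have : 0 <= k%:R * (q - 1) * (q - 1).
      by rewrite !mulr_ge0// ltW.
    lra.
  by rewrite ler_pM2l// (lt_trans _ q1).
have [k uk] : exists k : nat, u / (q - 1) <= k%:R.
  exists (Num.trunc `|u / (q - 1)|).+1.
  by rewrite (le_trans (ler_norm _))// ltW// truncnS_gt.
exists k; rewrite (le_trans _ (bern k))//.
by rewrite ler_wpDl// -ler_pdivrMr.
Qed.

Lemma nneseries_finite_support (R : realType) N :
  (\sum_(k <oo) ((k < N)%N%:R : R)%:E < +oo)%E.
Proof.
rewrite (nneseries_split 0 N); last by move=> k _; rewrite lee_fin.
rewrite add0n [X in (_ + X)%E](_ : _ = 0%E) ?adde0.
  by rewrite sumEFin ltry.
apply: eseries0 => k Nk _; by rewrite ltnNge Nk.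
Qed.

Section summable_deviation.
Local Open Scope ereal_scope.
Context d d' (T : measurableType d) (E : measurableType d') (R : realType).
Variables (P : probability T R) (F : {measure set E -> \bar R}).
Variables (g : E -> R) (m : R).
Hypothesis mg : measurable_fun setT g.
Hypothesis g0 : forall x, (0 <= g x)%R.
Hypothesis gm : \int[F]_x (g x)%:E = m%:E.

Lemma tail_integral_small (q e : R) : (1 < q)%R -> (0 < e)%R -> exists N, forall k,
  (N <= k)%N -> \int[F]_(x in [set x | (q ^+ k < g x)%R]) (g x)%:E <= e%:E.
Proof.
move=> q1 e0; have mgE : measurable_fun setT (EFin \o g) by exact/measurable_EFinP.
pose D k := [set x | (g x <= q ^+ k)%R].
have mD k : measurable (D k) by exact: measurable_set_le.
have Dm : \int[F]_(x in D k) (g x)%:E @[k --> \oo] --> m%:E.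
  rewrite -gm [X in _ --> X](_ : _ = \int[F]_(x in \bigcup_k D k) (g x)%:E).
    apply: ge0_nondecreasing_set_cvg_integral => //.
    - apply/nondecreasing_seqP => n; apply/subsetPset => x /= gx.
      rewrite /D/= (le_trans gx)// exprS ler_peMl ?(ltW q1)// exprn_ge0//.
      by rewrite ltW// (lt_trans _ q1).
    - by move=> k; exact: measurable_funTS.
    - by move=> k x _; rewrite lee_fin.
  congr integral; apply/esym/seteqP; split => // x _.
  by have [k gk] := pow_unbounded (g x) q1; exists k.
have mem : (m - e)%:E < m%:E by rewrite lte_fin ltrBlDr ltrDl.
have [N _ HN] := Dm _ (open_ereal_gt' mem).
exists N => k Nk; have /= := HN k Nk.
have DC : [set x | (q ^+ k < g x)%R] = ~` D k.
  by apply/seteqP; split => x /=; [rewrite ltNge => /negP|move/negP; rewrite -ltNge].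
have : \int[F]_(x in D k) (g x)%:E + \int[F]_(x in ~` D k) (g x)%:E = m%:E.
  rewrite -ge0_integral_setU//; first by rewrite setUv gm.
  - exact: measurableC.
  - by rewrite setUv.
  - by move=> x _; rewrite lee_fin.
  - by rewrite disj_set2E setICr eqxx.
rewrite DC.
have : 0 <= \int[F]_(x in ~` D k) (g x)%:E.
  by apply: integral_ge0 => x _; rewrite lee_fin.
have : 0 <= \int[F]_(x in D k) (g x)%:E.
  by apply: integral_ge0 => x _; rewrite lee_fin.
case: (\int[F]_(x in D k) _) => [a||]//; case: (\int[F]_(x in ~` _) _) => [b||]//.
rewrite -EFinD lte_fin !lee_fin => _ _ [<-]; lra.
Qed.

Lemma sum_truncation_cost (q e u : R) n : (1 < q)%R -> (0 < e)%R -> (0 <= u)%R ->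
  (\sum_(k < n) truncation_cost e (q ^+ k) u <=
   q / (q - 1) * (1 + 4 / e ^+ 2) * u)%R.
Proof.
move=> q1 e0 u0; rewrite /truncation_cost big_split/= -mulr_sumr.
have e2 : (0 <= 4 / e ^+ 2)%R by rewrite divr_ge0// sqr_ge0.
have := sum_pow_below n q1 u0.
have := ler_wpM2l e2 (sum_pow_above n q1 u0).
set x := (q / (q - 1))%R; set y := (4 / e ^+ 2)%R; lra.
Qed.

Lemma summable_truncation_cost (q e : R) : (1 < q)%R -> (0 < e)%R ->
  \sum_(k <oo) \int[F]_x (truncation_cost e (q ^+ k) (g x))%:E < +oo.
Proof.
move=> q1 e0; have q0 : (0 < q)%R by exact: lt_trans q1.
have c0 k x : (0 <= truncation_cost e (q ^+ k) (g x))%R.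
  by apply: truncation_cost_ge0; rewrite exprn_ge0// ltW.
have mc k : measurable_fun setT (fun x => (truncation_cost e (q ^+ k) (g x))%:E).
  by apply/measurable_EFinP; exact: measurable_truncation_cost.
rewrite -integral_nneseries//; last by move=> k x _; rewrite lee_fin.
pose C := (q / (q - 1) * (1 + 4 / e ^+ 2))%R.
have C0 : (0 <= C)%R.
  apply: mulr_ge0; first by apply: divr_ge0; rewrite ?subr_ge0 ltW.
  by rewrite addr_ge0// divr_ge0// sqr_ge0.
apply: (@le_lt_trans _ _ (\int[F]_x (C%:E * (g x)%:E))); last first.
  rewrite ge0_integralZl_EFin//; first by rewrite gm -EFinM ltry.
  - by move=> x _; rewrite lee_fin.
  - exact/measurable_EFinP.
apply: ge0_le_integral => //.
- by move=> x _; apply: nneseries_ge0 => k _ _; rewrite lee_fin.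
- by apply: ge0_emeasurable_sum => // k x _ _; rewrite lee_fin.
- by apply: measurable_funeM; exact/measurable_EFinP.
- move=> x _; apply: lime_le.
    by apply: is_cvg_nneseries => k _ _; rewrite lee_fin.
  apply: nearW => n; rewrite sumEFin -EFinM lee_fin big_mkord.
  exact: sum_truncation_cost.
Qed.

(** The sequence [p] is chosen before the random measure and before s. This uniformity over s <= q^k
    is what the maximal inequality consumes. *)
Lemma prm_deviation_summable (q e : R) : (1 < q)%R -> (0 < e)%R ->
  exists p : nat -> \bar R, [/\ forall k, 0 <= p k, \sum_(k <oo) p k < +oo &
    forall k (K : T -> {measure set E -> \bar R}) (s : {nonneg R}),
    poisson_random_measure P (fun w A => K w A) (mscale s F) ->
    (s%:num <= q ^+ k)%R ->
    P [set w | (e * q ^+ k < `|fine (\int[K w]_x (g x)%:E) - s%:num * m|)%R]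
      <= p k].
Proof.
move=> q1 e0; have q0 : (0 < q)%R by exact: lt_trans q1.
have e2 : (0 < e / 2)%R by rewrite divr_gt0.
have [N HN] := tail_integral_small q1 e2.
have c0 k : 0 <= \int[F]_x (truncation_cost e (q ^+ k) (g x))%:E.
  apply: integral_ge0 => x _; rewrite lee_fin.
  by apply: truncation_cost_ge0; rewrite exprn_ge0// ltW.
(* At the finitely many scales where the discarded tail still exceeds e / 2, the probability is
   bounded by 1. *)
exists (fun k => ((k < N)%N%:R)%:E +
  \int[F]_x (truncation_cost e (q ^+ k) (g x))%:E); split.
- by move=> k; rewrite adde_ge0// lee_fin.
- rewrite nneseriesD// ?lte_add_pinfty//.
  + exact: nneseries_finite_support.
  + exact: summable_truncation_cost.
- move=> k K s HK sq; have [kN|Nk] := ltnP k N.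
    rewrite (le_trans (probability_le1 _ _))// ?leeDl//.
    apply: measurable_set_lt => //; apply: measurableT_comp => //.
    by apply: measurable_funB => //; exact: (measurable_fine_prm_integral HK).
  rewrite add0e; apply: prm_deviation => //; first by rewrite exprn_gt0.
  exact: HN.
Qed.

End summable_deviation.

(** * Averages of monotone jump integrals *)

Lemma borel_cantelli_ae d (T : measurableType d) (R : realType)
    (P : {measure set T -> \bar R}) (A : (set T)^nat) (p : nat -> \bar R) :
  (forall k, measurable (A k)) -> (forall k, (P (A k) <= p k)%E) ->
  (\sum_(k <oo) p k < +oo)%E ->
  {ae P, forall w, exists N, forall k, (N <= k)%N -> ~ A k w}.
Proof.
move=> mA Ap poo; exists (lim_sup_set A); split.
- by apply: bigcap_measurable => // n _; apply: bigcup_measurable.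
- apply: lim_sup_set_cvg0 => //; rewrite (le_lt_trans _ poo)//.
  by apply: lee_nneseries => // k _; exact: measure_ge0.
- move=> w /= Nw n _; apply: contrapT => nA; apply: Nw; exists n => k nk Ak.
  by apply: nA; exists k.
Qed.

Lemma pow_bracket (R : realType) (q t : R) : 1 < q -> 1 <= t ->
  exists k, q ^+ k <= t < q ^+ k.+1.
Proof.
move=> q1 t1; have ex : exists k, t < q ^+ k.
  have [k tk] := pow_unbounded (t + 1) q1; exists k.
  by rewrite (lt_le_trans _ tk)// ltrDl.
case: (ex_minnP ex) => -[|k] tk kmin; first by rewrite expr0 ltNge t1 in tk.
exists k; rewrite tk andbT leNgt; apply/negP => /kmin; by rewrite ltnn.
Qed.

Lemma pow_bracket_large (R : realType) (q t : R) N k : 1 < q ->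
  q ^+ N <= t -> t < q ^+ k.+1 -> (N <= k)%N.
Proof.
move=> q1 Nt tk; rewrite leqNgt; apply/negP => kN.
have := le_lt_trans Nt tk; rewrite ltNge => /negP; apply.
by rewrite ler_eXn2l.
Qed.

(** For q^k <= t < q^(k+1), monotonicity traps J t between its values at the two scales, which costs
    a factor q. The ratios 1 + 1/(j+1) tend to 1 and are countable, so that the exceptional null
    sets can be united. *)
Lemma cvg_average_of_powers (R : realType) (J : R -> R) (m : R) :
  (forall s t, 0 <= s -> s <= t -> J s <= J t) ->
  (forall j i : nat, exists N, forall k, (N <= k)%N ->
    `|J ((1 + j.+1%:R^-1) ^+ k) - (1 + j.+1%:R^-1) ^+ k * m|
      <= i.+1%:R^-1 * (1 + j.+1%:R^-1) ^+ k) ->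
  0 <= m ->
  J t / t @[t --> +oo] --> m.
Proof.
move=> ndJ HJ m0; apply/cvgrPdist_le => e e0.
(* The mesh error is m (q - 1) = m / (j+1). *)
have [j jm] : exists j : nat, m / j.+1%:R <= e / 2.
  exists (Num.trunc (m / (e / 2))).
  by rewrite ler_pdivrMr// mulrC -ler_pdivrMr ?divr_gt0// ltW// truncnS_gt.
(* As q <= 2, the deviation at the upper scale is at most 2 t d, which leaves e / 2 after division
   by t. *)
have [i ie] : exists i : nat, i.+1%:R^-1 <= e / 4.
  exists (Num.trunc ((e / 4)^-1)).
  by rewrite invf_ple ?posrE ?divr_gt0// ltW// truncnS_gt.
have [N HN] := HJ j i; move: HN; set q := 1 + _; set d := i.+1%:R^-1 => HN.
have q1 : 1 < q by rewrite ltrDl.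
have q2 : q <= 2.
  by rewrite /q -[leRHS]/(1 + 1) lerD2l invf_le1// ler1n.
have q0 : 0 < q by exact: lt_trans q1.
exists (q ^+ N); split; first exact: num_real.
move=> t /ltW qt; have t1 : 1 <= t.
  by rewrite (le_trans _ qt)// exprn_ege1// ltW.
have t0 : 0 < t by exact: lt_le_trans t1.
have [k /andP[kt tk]] := pow_bracket q1 t1.
have Nk := pow_bracket_large q1 qt tk.
have := HN k Nk; have := HN k.+1 (leqW Nk).
have := ndJ _ _ (ltW t0) (ltW tk).
have qk0 : 0 < q ^+ k by rewrite exprn_gt0.
have := ndJ _ _ (ltW qk0) kt.
move: tk; rewrite exprS; set s := q ^+ k in kt qk0 *.
move=> tk J1 J2; rewrite !ler_norml => /andP[_ H1] /andP[H2 _].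
have mq : m * (q - 1) <= e / 2 by rewrite /q addrAC subrr add0r.
have d0 : 0 < d by rewrite invr_gt0.
have st_mq : s * (m * (q - 1)) <= t * (e / 2).
  by apply: ler_pM => //; [exact: ltW|rewrite mulr_ge0// subr_ge0 ltW].
have tmq : t * (m * (q - 1)) <= t * (e / 2) by rewrite ler_pM2l.
have td : t * d <= t * (e / 4) by rewrite ler_pM2l.
have sd : s * d <= t * d by rewrite ler_pM2r.
have qsd : q * (s * d) <= 2 * (t * d).
  by apply: ler_pM => //; [exact: ltW|rewrite mulr_ge0// ltW].
have qsm : q * s * m <= q * t * m by rewrite ler_wpM2r// ler_pM2l.
have tqs : t * m <= q * s * m by rewrite ler_wpM2r// ltW.
have U : J t / t <= m + e.
  by rewrite ler_pdivrMr//; move: J1 H1 qsd qsm td tmq; nra.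
have L : m - e <= J t / t.
  by rewrite ler_pdivlMr//; 
    move: J2 H2 st_mq tqs td sd (mulr_ge0 (ltW t0) (ltW e0)); nra.
by apply/andP; split; lra.
Qed.

Section jump_integral_law_of_large_numbers.
Context d (T : measurableType d) (R : realType) (P : probability T R).
Variables (X : R -> T -> R) (F : {measure set R -> \bar R}).
Hypothesis HN : poisson_random_measure P
  (fun w => jump_measure (X ^~ w)) (jump_intensity F).
Variables (D : set R) (g : R -> R) (m : R).
Hypothesis mD : measurable D.
Hypothesis mg : measurable_fun setT g.
Hypothesis g0 : forall x, 0 <= g x.
Hypothesis gm : (\int[F]_(x in D) (g x)%:E = m%:E)%E.

Let gD x : R := g x * \1_D x.

Let mgD : measurable_fun setT gD.
Proof. by apply: measurable_funM => //; exact: measurable_indic. Qed.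

Let gD0 x : 0 <= gD x.
Proof. by rewrite mulr_ge0. Qed.

Let gDE (mu : {measure set R -> \bar R}) :
  (\int[mu]_(x in D) (g x)%:E = \int[mu]_x (gD x)%:E)%E.
Proof.
rewrite integral_mkcond; apply: eq_integral => x _.
by rewrite patchE /gD indicE; case: ifPn => _; rewrite ?mulr1 ?mulr0.
Qed.

Lemma jump_integralE t w :
  jump_integral X D g t w = fine (\int[jumps_upto (X ^~ w) t]_x (gD x)%:E)%E.
Proof. by rewrite /jump_integral /Rintegral integral_jumps_upto// gDE. Qed.

Lemma jump_integral_deviation (q e : R) : 1 < q -> 0 < e ->
  exists p : nat -> \bar R, [/\ forall k, (0 <= p k)%E,
    (\sum_(k <oo) p k < +oo)%E &
    forall k s, 0 <= s -> s <= q ^+ k ->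
    (P [set w | (e * q ^+ k < `|jump_integral X D g s w - s * m|)%R] <= p k)%E].
Proof.
move=> q1 e0.
have gm' : (\int[F]_x (gD x)%:E = m%:E)%E by rewrite -gDE.
have [p [p0 poo Hp]] := prm_deviation_summable P mgD gD0 gm' q1 e0.
exists p; split => // k s s0 sq.
under eq_set do rewrite jump_integralE.
exact: Hp (prm_jumps_upto s0 HN) sq.
Qed.

Lemma measurable_jump_integral s : 0 <= s ->
  measurable_fun setT (jump_integral X D g s).
Proof.
move=> s0; rewrite (_ : jump_integral X D g s =
  fun w => fine (\int[jumps_upto (X ^~ w) s]_x (gD x)%:E)%E); last first.
  by apply/funext => w; exact: jump_integralE.
exact: (measurable_fine_prm_integral (prm_jumps_upto s0 HN)).
Qed.

(** Monotonicity could fail where the integral becomes infinite, because [fine] sends +oo to 0.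
    Almost sure finiteness at all integer times excludes this for all times at once. *)
Lemma jump_integral_nondecreasing :
  {ae P, forall w s t, 0 <= s -> s <= t ->
    jump_integral X D g s w <= jump_integral X D g t w}.
Proof.
have fin : {ae P, forall w, forall n : nat,
    (\int[jumps_upto (X ^~ w) n%:R]_x (gD x)%:E)%E \is a fin_num}.
  apply: ae_foralln => n.
  apply: (prm_integral_fin_num (prm_jumps_upto (ler0n R n) HN)).
  - exact/measurable_EFinP.
  - by move=> x; rewrite lee_fin.
  - rewrite ge0_integral_mscale//.
    + by rewrite -gDE gm -EFinM ltry.
    + exact/measurable_EFinP.
    + by move=> x; rewrite lee_fin.
have nd w s t : s <= t -> (\int[jumps_upto (X ^~ w) s]_x (gD x)%:E <=
    \int[jumps_upto (X ^~ w) t]_x (gD x)%:E)%E.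
  move=> st; rewrite -!gDE -!integral_jumps_upto//.
  apply: ge0_subset_integral => //.
  - exact: measurableX.
  - exact: measurableX.
  - apply/measurable_EFinP; apply: measurable_funTS.
    exact: measurableT_comp.
  - by move=> z; rewrite lee_fin.
  - move=> z [/= Dz]; rewrite !in_itv/= => /andP[z0 zs]; split => //=.
    by rewrite ?in_itv/= ?z0 (le_trans zs st).
apply: filterS fin => w fin s t s0 st.
have finE u : (\int[jumps_upto (X ^~ w) u]_x (gD x)%:E)%E \is a fin_num.
  have [n un] : exists n : nat, u <= n%:R.
    exists (Num.trunc `|u|).+1.
    by rewrite (le_trans (ler_norm _))// ltW// truncnS_gt.
  rewrite ge0_fin_numE; last by apply: integral_ge0 => x _; rewrite lee_fin.
  apply: le_lt_trans (nd w _ _ un) _.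
  by move: (fin n); rewrite fin_numElt => /andP[].
by rewrite !jump_integralE fine_le//; exact: nd.
Qed.

Lemma jump_integral_average :
  {ae P, forall w, jump_integral X D g t w / t @[t --> +oo] --> m}.
Proof.
have dev : {ae P, forall w, forall j i : nat, exists N, forall k, (N <= k)%N ->
    ~ (i.+1%:R^-1 * (1 + j.+1%:R^-1) ^+ k <
       `|jump_integral X D g ((1 + j.+1%:R^-1) ^+ k) w - (1 + j.+1%:R^-1) ^+ k * m|)}.
  apply: ae_foralln => j; apply: ae_foralln => i.
  have q1 : 1 < 1 + j.+1%:R^-1 :> R by rewrite ltrDl.
  have i0 : 0 < i.+1%:R^-1 :> R by [].
  have [p [p0 poo Hp]] := jump_integral_deviation q1 i0.
  have qk0 k : 0 <= (1 + j.+1%:R^-1) ^+ k :> R.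
    by rewrite exprn_ge0// ltW// (lt_trans _ q1).
  apply: (borel_cantelli_ae (p := p)) => // k.
  - apply: measurable_set_lt => //; apply: measurableT_comp => //.
    by apply: measurable_funB => //; exact: measurable_jump_integral.
  - exact: Hp.
apply: filterS2 jump_integral_nondecreasing dev => w nd dev.
apply: cvg_average_of_powers => //.
- move=> j i; have [N HNk] := dev j i; exists N => k Nk.
  by rewrite leNgt; apply/negP; exact: HNk.
- by rewrite -lee_fin -gm; apply: integral_ge0 => x _; rewrite lee_fin.
Qed.

End jump_integral_law_of_large_numbers.

(** * A maximal inequality for Lévy processes *)

Section maximal_inequality.
Local Open Scope ereal_scope.
Context d (T : measurableType d) (R : realType) (P : probability T R).

(** Both sides are finite measures in A that agree on the pi-system G. *)
Lemma independent_generated (G : set (set T)) (V : set T) :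
  G `<=` measurable -> setI_closed G -> G setT -> measurable V ->
  (forall C, G C -> P (C `&` V) = P C * P V) ->
  forall A, <<s G >> A -> P (A `&` V) = P A * P V.
Proof.
move=> Gm GI GT mV GV A sA.
pose v : {nonneg R} := NngNum (fine_ge0 (measure_ge0 P V)).
have vE : v%:num%:E = P V by rewrite /= fineK// fin_num_measure.
have -> : P (A `&` V) = mrestr P mV A by [].
rewrite muleC -vE -[RHS]/(mscale v P A).
apply: (@g_sigma_algebra_measure_unique _ _ _ G Gm (fun=> setT)) => //.
- by rewrite bigcup_const.
- by move=> C GC; rewrite /= /mrestr /mscale vE GV// muleC.
- by move=> k; rewrite /= /mrestr setTI -vE ltry.
Qed.

Variables (S : nat -> T -> R) (n : nat) (a : R) (p : \bar R).
Hypothesis mS : forall k, measurable_fun setT (S k).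

Definition first_exceed (k : nat) : set T :=
  [set w | (forall j, (j < k)%N -> (`|S j w| <= a + a)%R)] `&`
  [set w | (a + a < `|S k w|)%R].

(** The space is arbitrary because the lemma is also used with the sigma-algebra of the past, where
    it says that a first exceedance at k depends on the first k increments only. *)
Lemma first_exceed_measurable d' (T' : measurableType d') (Z : nat -> T' -> R) k :
  (forall j, (j <= k)%N -> measurable_fun setT (Z j)) ->
  measurable ([set w | (forall j, (j < k)%N -> (`|Z j w| <= a + a)%R)] `&`
  [set w | (a + a < `|Z k w|)%R]).
Proof.
move=> mZ; apply: measurableI; last first.
  by apply: measurable_set_lt => //; apply: measurableT_comp => //; exact: mZ.
rewrite (_ : [set w | _] =
    \bigcap_(j in `I_k) [set w | (`|Z j w| <= a + a)%R]); last by [].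
apply: bigcap_measurableType => j /= jk.
apply: measurable_set_le => //; apply: measurableT_comp => //.
by apply: mZ; exact: ltnW.
Qed.

Hypothesis indep : forall k, (k <= n)%N ->
  P (first_exceed k `&` [set w | (a < `|S n w - S k w|)%R]) =
  P (first_exceed k) * P [set w | (a < `|S n w - S k w|)%R].
Hypothesis incr : forall k, (k <= n)%N -> P [set w | (a < `|S n w - S k w|)%R] <= p.
Hypothesis endpt : P [set w | (a < `|S n w|)%R] <= p.

(* If [2 a] is first exceeded at time [k <= n], then either [|S n| > a] or
   [|S n - S k| > a]; the latter event is independent of the past up to [k]. *)
Lemma maximal_inequality :
  P [set w | exists2 k, (k <= n)%N & (a + a < `|S k w|)%R] <= p + p.
Proof.
have mfirst k : measurable (first_exceed k) by exact: first_exceed_measurable.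
have mV k : measurable [set w | (a < `|S n w - S k w|)%R].
  by apply: measurable_set_lt => //; apply: measurableT_comp => //; exact: measurable_funB.
have mend : measurable [set w | (a < `|S n w|)%R].
  by apply: measurable_set_lt => //; exact: measurableT_comp.
have tfirst : trivIset setT first_exceed.
  apply/trivIsetP => i j _ _ ij; wlog ij' : i j ij / (i < j)%N.
    move=> H; have [|ji|ij'] := ltngtP i j; first exact: H.
      by rewrite setIC; apply: H => //; rewrite eq_sym.
    by rewrite ij' eqxx in ij.
  rewrite -subset0 => w [[_ /= iw] [/= /(_ _ ij') jw _]].
  by move: jw; rewrite leNgt iw.
have p0 : 0 <= p by exact: le_trans endpt.
pose W k := first_exceed k `&` [set w | (a < `|S n w - S k w|)%R].
apply: (@le_trans _ _
    (P ([set w | (a < `|S n w|)%R] `|` \big[setU/set0]_(k < n.+1) W k))).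
  apply: le_measure; rewrite ?inE.
  - rewrite (_ : [set w | _] =
        \bigcup_(k in `I_n.+1) [set w | (a + a < `|S k w|)%R]); last first.
      by apply/seteqP; split => w /= [k kn kw]; exists k.
    apply: bigcup_measurable => k _.
    by apply: measurable_set_lt => //; exact: measurableT_comp.
  - by apply: measurableU => //; apply: bigsetU_measurable => k _; exact: measurableI.
  move=> w /= [k kn kw].
  have ex : exists k, (k <= n)%N && (a + a < `|S k w|)%R by exists k; rewrite kn.
  case: (ex_minnP ex) => j /andP[jn jw] jmin.
  have [nw|nw] := ltP a (`|S n w|)%R; [by left|right].
  rewrite -bigcup_mkord; exists j => //=; split; first split => //=.
    move=> i ij; rewrite leNgt; apply/negP => iw.
    have := jmin i; rewrite iw (leq_trans (ltnW ij))//= => /(_ isT).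
    by rewrite leqNgt ij.
  rewrite /= distrC; have := ler_distD (S n w) (S j w) 0%R.
  by rewrite !subr0; move: jw nw; lra.
apply: (le_trans (measureU2 _ mend _)).
  by apply: bigsetU_measurable => k _; exact: measurableI.
apply: leeD => //.
apply: (@le_trans _ _ (\sum_(k < n.+1) P (W k))).
  apply: Boole_inequality => k _; exact: measurableI.
apply: (@le_trans _ _ (\sum_(k < n.+1) P (first_exceed k) * p)).
  apply: lee_sum => k _; rewrite /W indep -1?ltnS// lee_wpmul2l//.
  by apply: incr; rewrite -ltnS.
rewrite -ge0_sume_distrl// -measure_bigsetU//.
  rewrite -[leRHS]mul1e lee_wpmul2r// probability_le1//.
  exact: bigsetU_measurable.
Qed.

End maximal_inequality.

(** * The maximal inequality along a time grid *)

Section levy_maximal_inequality.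
Local Open Scope ereal_scope.
Context d (T : measurableType d) (R : realType) (P : probability T R).
Variable X : R -> T -> R.
Hypothesis X_levy : levy_process P X.

Let mX (t : R) : (0 <= t)%R -> measurable_fun setT (X t).
Proof. by move=> t0; exact: (levy_measurable X_levy t0). Qed.

Section grid.
Variables (t : nat -> R) (n : nat) (m : R).
Hypothesis t0 : forall k, (0 <= t k)%R.
Hypothesis t_nd : forall i, (t i <= t i.+1)%R.

Let t_le i j : (i <= j)%N -> (t i <= t j)%R.
Proof. by move=> ij; have /nondecreasing_seqP/(_ _ _ ij) := t_nd. Qed.

Let xi i w : R := (X (t i.+1) w - X (t i) w)%R.

Let mxi i : measurable_fun setT (xi i).
Proof. by apply: measurable_funB; exact: mX. Qed.

(** A pi-system generating the past up to the grid time [t k]. *)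
Let cylinder k : set (set T) := [set C | exists2 U : nat -> set R,
  (forall i, measurable (U i)) &
  C = [set w | forall i, (i < k)%N -> U i (xi i w)]].

Let mcyl k C : cylinder k C -> measurable C.
Proof.
move=> [U mU ->]; rewrite (_ : [set w | _] =
    \bigcap_(i in `I_k) (xi i @^-1` U i)); last by [].
apply: bigcap_measurableType => i _; rewrite -[X in measurable X]setTI.
exact: mxi.
Qed.

Let cylI k : setI_closed (cylinder k).
Proof.
move=> _ _ [U mU ->] [V mV ->]; exists (fun i => U i `&` V i).
  by move=> i; exact: measurableI.
apply/seteqP; split => w /= UV; first by move=> i ik; split; apply UV.
by split => i ik; have [] := UV i ik.
Qed.

Let cylT k : cylinder k setT.
Proof. by exists (fun=> setT) => //; apply/seteqP; split. Qed.

Lemma cylinder_independent k C (V : set R) :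
  (k <= n)%N -> cylinder k C -> measurable V ->
  P (C `&` [set w | V (X (t n) w - X (t k) w)%R]) =
  P C * P [set w | V (X (t n) w - X (t k) w)%R].
Proof.
move=> kn [U mU ->] mV.
(* Merging all steps after k into one leaves k + 1 consecutive increments, the last one running from
   [t k] to [t n]. *)
pose t' i := if (i <= k)%N then t i else t n.
have t'0 : (0 <= t' 0%N)%R by rewrite /t' leq0n.
have t'nd i : (i < k.+1)%N -> (t' i <= t' i.+1)%R.
  rewrite ltnS /t' => ik; rewrite ik; case: ifPn => // _.
  by rewrite t_le// (leq_trans ik).
have H := levy_independent X_levy t'0 t'nd.
pose W V' (i : 'I_k.+1) : set R := if (i < k)%N then U i else V'.
have HW V' : measurable V' ->
    P ([set w | forall i, (i < k)%N -> U i (xi i w)] `&`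
       [set w | V' (X (t n) w - X (t k) w)%R]) =
    (\prod_(i < k) P [set w | U i (xi i w)]) *
    P [set w | V' (X (t n) w - X (t k) w)%R].
  move=> mV'; have mW i : measurable (W V' i) by rewrite /W; case: ifP.
  have := H _ mW; rewrite big_ord_recr/= => HE.
  transitivity (P (\bigcap_(i in [set: 'I_k.+1])
      ((fun w => X (t' i.+1) w - X (t' i) w)%R @^-1` W V' i))).
    congr (P _); apply/seteqP; split => w /=.
      move=> [Uw Vw] i _ /=; rewrite /W /t'; case: ltnP => ik.
        by rewrite ltnW//; exact: Uw.
      have -> : (i : nat) = k by apply/eqP; rewrite eqn_leq ik -ltnS ltn_ord.
      by rewrite leqnn.
    move=> Ww; split => [i ik|].
      have := Ww (widen_ord (leqnSn k) (Ordinal ik)) I.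
      by rewrite /W /t'/= ik (ltnW ik).
    by have := Ww ord_max I; rewrite /W /t'/= ltnn leqnn.
  rewrite HE; congr (_ * _).
    apply: eq_bigr => i _; rewrite /W /t'/= ltn_ord (ltnW (ltn_ord i)).
    by [].
  by rewrite /W /t'/= ?ltnn ?leqnn ?ltnn.
rewrite HW//; congr (_ * _).
(* With no condition on the last increment, the same factorization computes the probability of the
   cylinder itself. *)
have := HW setT measurableT; rewrite setIT => ->.
by rewrite [X in _ * X](_ : _ = 1) ?mule1// probability_setT.
Qed.

Let S k w : R := (X (t k) w - X (t 0%N) w - m * (t k - t 0%N))%R.

Lemma sums_measurable_cylinder k j : (j <= k)%N ->
  @measurable_fun _ _ (g_sigma_algebraType (cylinder k)) R setT (S j).
Proof.
elim: j => [_|j IH jk].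
  rewrite (_ : S 0%N = cst 0%R); first exact: measurable_cst.
  by apply/funext => w; rewrite /S !subrr mulr0 subrr.
rewrite (_ : S j.+1 = (fun w => S j w + (xi j w - m * (t j.+1 - t j))))%R; last first.
  by apply/funext => w; rewrite /S /xi; ring.
apply: measurable_funD; first by apply: IH; exact: ltnW.
apply: measurable_funB; last exact: measurable_cst.
move=> _ U mU; rewrite setTI; apply: sub_sigma_algebra.
exists (fun i => if i == j then U else setT).
  by move=> i; case: ifP.
apply/seteqP; split => w /=; first by move=> Uw i ik; case: eqP => // ->.
by move=> /(_ j jk); rewrite eqxx.
Qed.

Lemma levy_grid_maximal (a : R) (p : \bar R) :
  (forall s, (0 <= s)%R -> (s <= t n)%R ->
    P [set w | (a < `|X s w - m * s|)%R] <= p) ->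
  P [set w | exists2 k, (k <= n)%N & (a + a < `|S k w|)%R] <= p + p.
Proof.
move=> Hp.
have SE k w : (S n w - S k w = (X (t n) w - X (t k) w) - m * (t n - t k))%R.
  by rewrite /S; ring.
have mU h : measurable [set x : R | (a < `|x - m * h|)%R].
  apply: measurable_set_lt => //; apply: measurableT_comp => //.
  exact: measurable_funB.
have mS k : measurable_fun setT (S k).
  by apply: measurable_funB => //; apply: measurable_funB; exact: mX.
(* By stationarity this increment has the law of X at time [t n - t k], centered by its own drift,
   so that a bound at fixed times is enough. *)
have incr k : (k <= n)%N -> P [set w | (a < `|S n w - S k w|)%R] <= p.
  move=> kn; under eq_set do rewrite SE.
  have tkn : (0 <= t n - t k)%R by rewrite subr_ge0 t_le.
  have := levy_stationary X_levy (t0 k) tkn (mU (t n - t k)%R).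
  rewrite (addrC (t k)) subrK /= => ->.
  by apply: Hp => //; rewrite lerBlDr lerDl.
apply: maximal_inequality => //.
- move=> k kn; under [X in P (_ `&` X)]eq_set do rewrite SE.
  under [X in _ * P X]eq_set do rewrite SE.
  apply: (@independent_generated _ _ _ P (cylinder k)) => //.
  + by move=> C /mcyl.
  + apply: measurable_set_lt => //; apply: measurableT_comp => //.
    by apply: measurable_funB => //; apply: measurable_funB; exact: mX.
  + by move=> C cC; exact: (cylinder_independent kn cC (mU (t n - t k)%R)).
  + apply: (@first_exceed_measurable R a _ (g_sigma_algebraType (cylinder k)) S k).
    by move=> j; exact: sums_measurable_cylinder.
- have := incr 0%N (leq0n _).
  by under eq_set do rewrite (_ : S 0%N _ = 0%R) ?subr0 ?/S ?subrr ?mulr0 ?subrr//.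
Qed.

End grid.

End levy_maximal_inequality.

Lemma dyadic_point (R : realType) (T0 t e : R) : 0 < T0 -> 0 <= t -> t < T0 ->
  0 < e -> exists N k, [/\ (k <= 2 ^ N)%N, t < T0 * (k%:R / 2 ^+ N) &
    T0 * (k%:R / 2 ^+ N) < t + e].
Proof.
(* A mesh below [e] puts the next grid point within [e] of [t]; a mesh below [T0 - t] keeps it at
   most [T0], that is [k <= 2 ^ N]. *)
move=> T00 t0 tT e0; pose r := Num.min e (T0 - t).
have r0 : 0 < r by rewrite lt_min e0 subr_gt0.
have [N HN] := @pow_unbounded R 2 (T0 / r + 1) (ltr1n R 2).
have p0 : 0 < 2 ^+ N :> R by rewrite exprn_gt0.
have step : T0 / 2 ^+ N < r.
  rewrite ltr_pdivrMr// mulrC -ltr_pdivrMr//; move: HN; lra.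
pose k := (Num.trunc (t / T0 * 2 ^+ N)).+1.
have kl : t / T0 * 2 ^+ N < k%:R by exact: truncnS_gt.
have ku : k%:R <= t / T0 * 2 ^+ N + 1.
  rewrite /k -natr1 lerD2r truncn_le// mulr_ge0// ?divr_ge0//; exact: ltW.
have lo : t < T0 * (k%:R / 2 ^+ N).
  have : t / T0 < k%:R / 2 ^+ N by rewrite ltr_pdivlMr.
  by rewrite ltr_pdivrMr// mulrC.
have hi : T0 * (k%:R / 2 ^+ N) <= t + T0 / 2 ^+ N.
  have -> : t + T0 / 2 ^+ N = T0 * ((t / T0 * 2 ^+ N + 1) / 2 ^+ N).
    by field; rewrite !gt_eqF.
  by rewrite ler_pM2l// ler_pM2r// invr_gt0.
exists N, k; split => //; last first.
  by rewrite (le_lt_trans hi)// ltrD2l (lt_le_trans step)// ge_min lexx.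
rewrite -(ler_nat R) natrX.
have : T0 * (k%:R / 2 ^+ N) <= T0 * 1.
  rewrite mulr1 (le_trans hi)// addrC -lerBrDr ltW// (lt_le_trans step)//.
  by rewrite ge_min lexx orbT.
by rewrite ler_pM2l// ler_pdivrMr// mul1r.
Qed.

Section levy_average.
Context d (T : measurableType d) (R : realType) (P : probability T R).
Variable X : R -> T -> R.
Hypothesis X_levy : levy_process P X.

Let mX (t : R) : 0 <= t -> measurable_fun setT (X t).
Proof. by move=> t0; exact: (levy_measurable X_levy t0). Qed.

(** The exceedance events on dyadic grids increase with the grid, so their union obeys the same
    bound. A strict exceedance persists just to the right of t by right-continuity, hence is seen at
    a dyadic point. *)
Lemma levy_maximal (T0 m a : R) (p : \bar R) : 0 < T0 ->
  (forall s, 0 <= s -> s <= T0 -> (P [set w | (a < `|X s w - m * s|)%R] <= p)%E) ->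
  exists E, [/\ measurable E, (P E <= p + p)%E &
    forall w, cadlag (X ^~ w) -> ~ E w ->
    forall t, 0 <= t -> t <= T0 -> `|X t w - X 0 w - m * t| <= a + a].
Proof.
move=> T00 Hp.
pose t N (k : nat) : R := T0 * (k%:R / 2 ^+ N).
have p0 N : 0 < 2 ^+ N :> R by rewrite exprn_gt0.
have t0 N k : 0 <= t N k by rewrite mulr_ge0// ?divr_ge0// ltW.
have tnd N i : t N i <= t N i.+1.
  by rewrite ler_pM2l// ler_pM2r ?invr_gt0// ler_nat.
have tT N : t N (2 ^ N)%N = T0 by rewrite /t natrX divff ?mulr1// gt_eqF.
have tt0 N : t N 0%N = 0 by rewrite /t mul0r mulr0.
pose Y s w := X s w - X 0 w - m * s.
have mY s : 0 <= s -> measurable_fun setT (Y s).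
  by move=> s0; apply: measurable_funB => //; apply: measurable_funB; exact: mX.
pose E N := [set w | exists2 k, (k <= 2 ^ N)%N & (a + a < `|Y (t N k) w|)%R].
have mE N : measurable (E N).
  rewrite (_ : E N = \bigcup_(k in `I_(2 ^ N).+1) [set w | (a + a < `|Y (t N k) w|)%R]).
    apply: bigcup_measurable => k _; apply: measurable_set_lt => //.
    by apply: measurableT_comp => //; exact: mY.
  by apply/seteqP; split => w [k kn kw]; exists k.
have PE N : (P (E N) <= p + p)%E.
  have HpN s : 0 <= s -> s <= t N (2 ^ N)%N ->
      (P [set w | (a < `|X s w - m * s|)%R] <= p)%E by rewrite tT; exact: Hp.
  have := levy_grid_maximal X_levy (t0 N) (tnd N) HpN.
  rewrite tt0; rewrite [X in (P X <= _)%E](_ : _ = E N)//.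
  by apply/seteqP; split => w [k kn kw]; exists k => //; move: kw; rewrite /Y subr0.
have ndE : nondecreasing_seq E.
  apply/nondecreasing_seqP => N; apply/subsetPset => w [k kN kw].
  exists (k * 2)%N; first by rewrite expnSr leq_mul2r kN orbT.
  rewrite (_ : t N.+1 (k * 2)%N = t N k)// /t natrM exprSr.
  by congr (_ * _); field; rewrite gt_eqF.
exists (\bigcup_N E N); split.
- exact: bigcupT_measurable.
- have cvgE : P (E N) @[N --> \oo] --> P (\bigcup_N E N).
    by apply: nondecreasing_cvg_mu => //; exact: bigcupT_measurable.
  rewrite -(cvg_lim _ cvgE)//.
  apply: lime_le; last exact: nearW.
  by apply: ereal_nondecreasing_is_cvgn => i j ij; apply: le_measure; rewrite ?inE//;
    exact/subsetPset/ndE.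
(* The endpoint [T0] has no grid point to its right, but belongs to the coarsest grid. *)
- move=> w [rc _] nE s s0; rewrite le_eqVlt => /predU1P[->|sT].
    rewrite leNgt; apply/negP => Yw; apply: nE; exists 0%N => //.
    by exists 1%N => //; rewrite /t expr0 divr1 mulr1.
  rewrite leNgt; apply/negP => Yw.
  have cY : Y u w @[u --> s^'+] --> Y s w.
    apply: cvgB; first by apply: cvgB; [exact: rc|exact: cvg_cst].
    apply: cvg_at_right_filter; apply: cvgM; [exact: cvg_cst|exact: cvg_id].
  have /nbhs_ballP[e /= e0 He] : nbhs s (fun u => s < u -> a + a < `|Y u w|).
    exact: (cvgr_norm_gt _ cY _ Yw).
  have [N [k [kN lo hi]]] := dyadic_point T00 s0 sT e0.
  apply: nE; exists N => //; exists k => //; apply: He => //.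
  by rewrite /ball/= ltr_norml; rewrite -/(t N k) in lo hi *; apply/andP; split; lra.
Qed.

(** The supremum over [0, 2^(k+1)] controls every t in [2^k, 2^(k+1)) up to a constant factor, so
    the single ratio 2 suffices here. *)
Lemma levy_average (m : R) :
  (forall e, 0 < e -> exists p : nat -> \bar R, [/\ forall k, (0 <= p k)%E,
    (\sum_(k <oo) p k < +oo)%E &
    forall k s, 0 <= s -> s <= 2 ^+ k ->
      (P [set w | (e * 2 ^+ k < `|X s w - m * s|)%R] <= p k)%E]) ->
  {ae P, forall w, X t w / t @[t --> +oo] --> m}.
Proof.
move=> Hp.
have dev : {ae P, forall w, forall i : nat, exists N, forall k, (N <= k)%N ->
    cadlag (X ^~ w) -> forall t, 0 <= t -> t <= 2 ^+ k ->
    `|X t w - X 0 w - m * t| <= i.+1%:R^-1 * 2 ^+ k + i.+1%:R^-1 * 2 ^+ k}.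
  apply: ae_foralln => i.
  have i0 : 0 < i.+1%:R^-1 :> R by [].
  have [p [p0 poo Hpi]] := Hp _ i0.
  have maxl k := levy_maximal (exprn_gt0 k (ltr0Sn R 1)) (Hpi k).
  pose E k := sval (cid (maxl k)).
  have HE k : [/\ measurable (E k), (P (E k) <= p k + p k)%E &
    forall w, cadlag (X ^~ w) -> ~ E k w ->
    forall t, 0 <= t -> t <= 2 ^+ k -> `|X t w - X 0 w - m * t| <=
      i.+1%:R^-1 * 2 ^+ k + i.+1%:R^-1 * 2 ^+ k] := svalP (cid (maxl k)).
  have : {ae P, forall w, exists N, forall k, (N <= k)%N -> ~ E k w}.
    apply: (borel_cantelli_ae (p := fun k => (p k + p k)%E)).
    - by move=> k; have [] := HE k.
    - by move=> k; have [] := HE k.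
    - by rewrite nneseriesD// lte_add_pinfty.
  apply: filterS => w [N HN]; exists N => k Nk cw.
  by have [_ _] := HE k; apply => //; exact: HN.
apply: filterS3 (levy_cadlag X_levy) (levy_start X_levy) dev => w cw X0 dev.
apply/cvgrPdist_le => e e0.
(* The bound 2 c 2^(k+1) equals 4 c 2^k, which is at most 4 c t. *)
have [i ie] : exists i : nat, i.+1%:R^-1 <= e / 4.
  exists (Num.trunc ((e / 4)^-1)).
  by rewrite invf_ple ?posrE ?divr_gt0// ltW// truncnS_gt.
have [N HN] := dev i; move: HN; set c := _^-1 => HN.
exists (2 ^+ N); split; first exact: num_real.
move=> t /ltW Nt; have t1 : 1 <= t.
  by rewrite (le_trans _ Nt)// exprn_ege1// ler1n.
have t0 : 0 < t by exact: lt_le_trans t1.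
have q1 : 1 < 2 :> R by rewrite ltr1n.
have [k /andP[kt tk]] := pow_bracket q1 t1.
have Nk := pow_bracket_large q1 Nt tk.
have := HN _ (leqW Nk) cw _ (ltW t0) (ltW tk); rewrite X0 subr0 => H.
have Ht : `|X t w - m * t| <= e * t.
  apply: (le_trans H); rewrite exprS.
  have : c * 2 ^+ k <= e / 4 * t.
    by apply: ler_pM => //; rewrite ?invr_ge0// exprn_ge0.
  lra.
have -> : m - X t w / t = - ((X t w - m * t) / t) by field; rewrite gt_eqF.
by rewrite normrN normrM normfV [`|t|]gtr0_norm// ler_pdivrMr.
Qed.

End levy_average.

(** * Second moments of the Brownian and compensated parts *)

Section normal_second_moment.
Context (R : realType).
Implicit Type s : R.

(* The density at twice the scale absorbs the factor [x ^+ 2], so that no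
   integration by parts is needed for the second moment. *)
Lemma normal_pdf_sqr_le s x : 0 < s ->
  x ^+ 2 * normal_pdf 0 s x <= 16 * s ^+ 2 * normal_pdf 0 (2 * s) x.
Proof.
move=> s0; have s20 : 0 < 2 * s by rewrite mulr_gt0.
rewrite !normal_pdfE ?gt_eqF//.
have pE : normal_peak s = 2 * normal_peak (2 * s).
  rewrite /normal_peak.
  rewrite (_ : (2 * s) ^+ 2 * pi *+ 2 = 2 ^+ 2 * (s ^+ 2 * pi *+ 2)); last first.
    by rewrite exprMn -mulrA mulrnAr.
  rewrite sqrtrM ?sqr_ge0// sqrtr_sqr ger0_norm// invfM mulrA divff ?mul1r//.
(* In this variable the Gaussian factor is exp(-4v) at scale s and exp(-v) at scale 2s. Since v
   exp(-3v) <= 1, the constant is 16 = 8 * 2, from x^2 = 8 s^2 v and from the ratio of the peaks. *)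
pose v := x ^+ 2 / (8 * s ^+ 2).
have v0 : 0 <= v by rewrite divr_ge0 ?sqr_ge0// mulr_ge0 ?sqr_ge0.
have f1 : normal_fun 0 s x = expR (- v) * expR (- (3 * v)).
  rewrite -expRD /normal_fun subr0; congr expR; rewrite /v; field.
  by rewrite gt_eqF.
have f2 : normal_fun 0 (2 * s) x = expR (- v).
  rewrite /normal_fun subr0; congr expR; rewrite /v; field.
  by rewrite gt_eqF.
have ve : v * expR (- (3 * v)) <= 1.
  rewrite expRN ler_pdivrMr ?expR_gt0// mul1r (le_trans _ (expR_ge1Dx _))//; lra.
have xv : x ^+ 2 = 8 * s ^+ 2 * v by rewrite /v; field; rewrite gt_eqF.
rewrite pE f1 f2 xv.
have -> : 8 * s ^+ 2 * v *
    (2 * normal_peak (2 * s) * (expR (- v) * expR (- (3 * v)))) =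
  16 * s ^+ 2 * (normal_peak (2 * s) * expR (- v)) * (v * expR (- (3 * v))) by ring.
rewrite ler_piMr//.
by apply: mulr_ge0; rewrite mulr_ge0 ?sqr_ge0 ?normal_peak_ge0 ?expR_ge0.
Qed.

Lemma normal_prob_second_moment s : 0 < s ->
  (\int[normal_prob 0 s]_x (x ^+ 2)%:E <= (16 * s ^+ 2)%:E)%E.
Proof.
move=> s0.
have mx2 : measurable_fun setT (fun x : R => (x ^+ 2)%:E).
  by apply/measurable_EFinP; exact: measurable_funX.
have [nu [nuE nuI]] := density_measure (@lebesgue_measure R)
  (measurable_normal_pdf 0 s) (normal_pdf_ge0 0 s).
rewrite (eq_measure_integral nu); last by move=> A mA _; rewrite nuE.
rewrite nuI//; last by move=> x; rewrite lee_fin sqr_ge0.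
apply: (@le_trans _ _ (\int[lebesgue_measure]_x
    ((16 * s ^+ 2)%:E * (normal_pdf 0 (2 * s) x)%:E))%E).
  apply: ge0_le_integral => //.
  - by move=> x _; rewrite mule_ge0// lee_fin ?sqr_ge0// normal_pdf_ge0.
  - by apply: emeasurable_funM => //; apply/measurable_EFinP; exact: measurable_normal_pdf.
  - by apply: measurable_funeM; apply/measurable_EFinP; exact: measurable_normal_pdf.
  - by move=> x _; rewrite -!EFinM lee_fin mulrC normal_pdf_sqr_le.
rewrite ge0_integralZl_EFin//; last 3 first.
- by move=> x _; rewrite lee_fin normal_pdf_ge0.
- by apply/measurable_EFinP; exact: measurable_normal_pdf.
- by rewrite mulr_ge0// sqr_ge0.
by rewrite integral_normal_pdf mule1.
Qed.

End normal_second_moment.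

Lemma brownian_second_moment d (T : measurableType d) (R : realType)
    (P : probability T R) (B : R -> T -> R) (t : R) :
  standard_brownian_motion P B -> 0 <= t ->
  (\int[P]_w (B t w ^+ 2)%:E <= (16 * t)%:E)%E.
Proof.
move=> HB t0; have mB s : 0 <= s -> measurable_fun setT (B s).
  by move=> s0; exact: (brownian_measurable HB).
have mB2 : measurable_fun setT (fun w => (B t w ^+ 2)%:E).
  by apply/measurable_EFinP; apply: measurable_funX; exact: mB.
(* The Gaussian law is prescribed between distinct times only; at t = 0 the starting value
   decides. *)
move: t0; rewrite le_eqVlt => /predU1P[t0|t0].
  rewrite -t0 mulr0 (_ : integral _ _ _ = 0%E)//.
  transitivity (\int[P]_w (cst 0%E w))%E; last exact: integral0.
  apply: ae_eq_integral => //; first by rewrite t0.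
  by apply: filterS (brownian_start HB) => w /= ->; rewrite expr0n.
pose Y w := B t w - B 0 w.
have mY : measurable_fun setT Y by apply: measurable_funB; apply: mB => //; exact: ltW.
have mY' : @measurable_fun _ _ T (measurableTypeR R) setT Y by exact: mY.
pose Y' : {mfun T >-> measurableTypeR R} :=
  HB.pack (Y : T -> measurableTypeR R) (isMeasurableFun.Build _ _ _ _ _ mY').
rewrite (ge0_ae_eq_integral (g := fun w => (Y w ^+ 2)%:E))//; last 4 first.
- by apply/measurable_EFinP; exact: measurable_funX.
- by move=> w _; rewrite lee_fin sqr_ge0.
- by move=> w _; rewrite lee_fin sqr_ge0.
- by apply: filterS (brownian_start HB) => w /= B0 _; rewrite /Y B0 subr0.
have st : 0 < Num.sqrt t by rewrite sqrtr_gt0.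
rewrite -[leRHS](_ : (16 * Num.sqrt t ^+ 2)%:E = _); last by rewrite sqr_sqrtr// ltW.
apply: le_trans (normal_prob_second_moment st).
rewrite -(@ge0_integral_distribution _ _ _ _ _ P Y' (fun x => (x ^+ 2)%:E)); last 2 first.
- by apply/measurable_EFinP; exact: measurable_funX.
- by move=> x; rewrite lee_fin sqr_ge0.
rewrite le_eqVlt; apply/orP; left; apply/eqP.
apply: eq_measure_integral => A mA _.
by have := brownian_gaussian HB (lexx 0) t0 mA; rewrite subr0.
Qed.

(** * Signed jump integrals *)

Section signed_jump_integral.
Context d (T : measurableType d) (R : realType) (P : probability T R).
Variables (X : R -> T -> R) (F : {measure set R -> \bar R}).
Hypothesis HN : poisson_random_measure P
  (fun w => jump_measure (X ^~ w)) (jump_intensity F).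
Implicit Types (D : set R) (g : R -> R).

Lemma integral_pos_neg d' (E : measurableType d') (mu : {measure set E -> \bar R})
    (D : set E) (g : E -> R) :
  (\int[mu]_(x in D) (g x)%:E = \int[mu]_(x in D) (Num.max (g x) 0)%:E -
    \int[mu]_(x in D) (Num.max (- g x) 0)%:E)%E.
Proof.
rewrite integralE; congr (_ - _)%E; apply: eq_integral => x _.
  by rewrite funeposE EFin_max.
by rewrite funenegE EFin_max.
Qed.

(** [fine] commutes with a difference of finite values; finiteness of both F-integrals makes the two
    path integrals finite almost surely. *)
Lemma jump_integral_pos_neg D g (a b t : R) : measurable D ->
  measurable_fun setT g -> 0 <= t ->
  (\int[F]_(x in D) (funrpos g x)%:E = a%:E)%E ->
  (\int[F]_(x in D) (funrneg g x)%:E = b%:E)%E ->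
  {ae P, forall w, jump_integral X D g t w =
    jump_integral X D (funrpos g) t w - jump_integral X D (funrneg g) t w}.
Proof.
move=> mD mg t0 ga gb.
have fin (h : R -> R) (c : R) : measurable_fun setT h -> (forall x, 0 <= h x) ->
    (\int[F]_(x in D) (h x)%:E = c%:E)%E ->
    {ae P, forall w,
      (\int[jumps_upto (X ^~ w) t]_(x in D) (h x)%:E)%E \is a fin_num}.
  move=> mh h0 hc.
  have mhE : measurable_fun setT ((EFin \o h) \_ D).
    by apply/(measurable_restrictT _ mD); apply: measurable_funTS; exact/measurable_EFinP.
  have hE x : (0 <= ((EFin \o h) \_ D) x)%E.
    by rewrite patchE; case: ifPn => // _; rewrite lee_fin.
  have := prm_integral_fin_num (prm_jumps_upto t0 HN) mhE hE.
  rewrite ge0_integral_mscale// -integral_mkcond hc -EFinM ltry => /(_ isT).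
  by apply: filterS => w; rewrite -integral_mkcond.
have fina := fin _ _ (measurable_funrpos mg) (funrpos_ge0 g) ga.
have finb := fin _ _ (measurable_funrneg mg) (funrneg_ge0 g) gb.
apply: filterS2 fina finb => w wa wb.
have mp := measurable_funrpos mg; have mn := measurable_funrneg mg.
rewrite /jump_integral /Rintegral (integral_jumps_upto _ _ mD mg).
rewrite (integral_jumps_upto _ _ mD mp) (integral_jumps_upto _ _ mD mn).
by rewrite integral_pos_neg fineB.
Qed.

Lemma measurable_signed_jump_integral D g (t : R) : measurable D ->
  measurable_fun setT g -> 0 <= t ->
  measurable_fun setT (jump_integral X D g t).
Proof.
move=> mD mg t0.
have mI (h : R -> R) : measurable_fun setT h -> (forall x, 0 <= h x) ->
    measurable_fun setT (fun w => (\int[jumps_upto (X ^~ w) t]_(x in D) (h x)%:E)%E).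
  move=> mh h0; under eq_fun do rewrite integral_mkcond.
  apply: (measurable_prm_integral (prm_jumps_upto t0 HN)).
    by apply/(measurable_restrictT _ mD); apply: measurable_funTS; exact/measurable_EFinP.
  by move=> x; rewrite patchE; case: ifPn => // _; rewrite lee_fin.
rewrite (_ : jump_integral X D g t = fun w =>
    fine (\int[jumps_upto (X ^~ w) t]_(x in D) (funrpos g x)%:E -
          \int[jumps_upto (X ^~ w) t]_(x in D) (funrneg g x)%:E)%E); last first.
  apply/funext => w; rewrite /jump_integral /Rintegral integral_jumps_upto//.
  by rewrite integral_pos_neg.
apply: measurableT_comp => //; apply: emeasurable_funB.
- by apply: mI; [exact: measurable_funrpos|exact: funrpos_ge0].
- by apply: mI; [exact: measurable_funrneg|exact: funrneg_ge0].
Qed.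

Lemma ge0_jump_integral_variance D g (a t : R) : measurable D ->
  measurable_fun setT g -> (forall x, 0 <= g x) -> 0 <= t ->
  (\int[F]_(x in D) (g x)%:E = a%:E)%E ->
  (\int[P]_w ((jump_integral X D g t w - t * a) ^+ 2)%:E =
   t%:E * \int[F]_(x in D) (g x ^+ 2)%:E)%E.
Proof.
move=> mD mg g0 t0 ga.
pose gD x := g x * \1_D x.
have mgD : measurable_fun setT gD.
  by apply: measurable_funM => //; exact: measurable_indic.
have gD0 x : 0 <= gD x by rewrite mulr_ge0.
under eq_integral do rewrite (jump_integralE _ mD mg).
rewrite (prm_integral_variance (prm_jumps_upto t0 HN) mgD gD0); last first.
  rewrite ge0_integral_mscale//; last 2 first.
  - exact/measurable_EFinP.
  - by move=> x _; rewrite lee_fin.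
  rewrite EFinM -ga; congr (_ * _)%E; rewrite [RHS]integral_mkcond.
  apply: eq_integral => x _.
  by rewrite patchE /gD indicE; case: ifPn => _; rewrite ?mulr1 ?mulr0.
rewrite ge0_integral_mscale//; last 2 first.
- by apply/measurable_EFinP; exact: measurable_funX.
- by move=> x _; rewrite lee_fin sqr_ge0.
congr (_ * _)%E; rewrite [RHS]integral_mkcond; apply: eq_integral => x _.
rewrite patchE /gD indicE.
by case: ifPn => _; rewrite ?mulr1 ?mulr0 ?expr0n.
Qed.

(** The two parts are centered separately, [second_momentD] costs the factor 2, and the squares of
    the parts add up to the square of [g]. *)
Lemma jump_integral_second_moment D g (a b t : R) : measurable D ->
  measurable_fun setT g -> 0 <= t ->
  (\int[F]_(x in D) (funrpos g x)%:E = a%:E)%E ->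
  (\int[F]_(x in D) (funrneg g x)%:E = b%:E)%E ->
  (\int[P]_w ((jump_integral X D g t w - t * (a - b)) ^+ 2)%:E <=
   (2 * t)%:E * \int[F]_(x in D) (g x ^+ 2)%:E)%E.
Proof.
move=> mD mg t0 ga gb.
have mpos := measurable_funrpos mg; have mneg := measurable_funrneg mg.
have mJ (h : R -> R) : measurable_fun setT h -> measurable_fun setT (jump_integral X D h t).
  by move=> mh; exact: measurable_signed_jump_integral.
pose Y w := jump_integral X D (funrpos g) t w - t * a.
pose Z w := - (jump_integral X D (funrneg g) t w - t * b).
have mY : measurable_fun setT Y by apply: measurable_funB => //; exact: mJ.
have mZ : measurable_fun setT Z.
  by apply: measurableT_comp => //; apply: measurable_funB => //; exact: mJ.
rewrite (ge0_ae_eq_integral (g := fun w => ((Y w + Z w) ^+ 2)%:E))//; last 5 first.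
- by apply/measurable_EFinP; apply: measurable_funX; apply: measurable_funB => //; exact: mJ.
- by apply/measurable_EFinP; apply: measurable_funX; exact: measurable_funD.
- by move=> w _; rewrite lee_fin sqr_ge0.
- by move=> w _; rewrite lee_fin sqr_ge0.
- apply: filterS (jump_integral_pos_neg mD mg t0 ga gb) => w -> _.
  by congr (_ ^+ 2)%:E; rewrite /Y /Z; ring.
apply: (le_trans (second_momentD P mY mZ)).
rewrite /Y (ge0_jump_integral_variance mD mpos (funrpos_ge0 g) t0 ga).
rewrite /Z; under [X in (_ + _ * X)%E]eq_integral do rewrite sqrrN.
rewrite (ge0_jump_integral_variance mD mneg (funrneg_ge0 g) t0 gb).
rewrite !muleA -EFinM -ge0_muleDr; last 2 first.
- by apply: integral_ge0 => x _; rewrite lee_fin sqr_ge0.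
- by apply: integral_ge0 => x _; rewrite lee_fin sqr_ge0.
rewrite -ge0_integralD//; last 4 first.
- by move=> x _; rewrite lee_fin sqr_ge0.
- by apply/measurable_EFinP; apply: measurable_funX; exact: measurable_funTS.
- by move=> x _; rewrite lee_fin sqr_ge0.
- by apply/measurable_EFinP; apply: measurable_funX; exact: measurable_funTS.
rewrite le_eqVlt; apply/orP; left; apply/eqP; congr (_ * _)%E.
apply: eq_integral => x _; rewrite -EFinD; congr EFin.
rewrite /funrpos /funrneg; case: (lerP 0 (g x)) => gx.
  by rewrite max_r ?oppr_le0// expr0n addr0.
by rewrite max_l ?oppr_ge0 ?ltW// expr0n add0r sqrrN.
Qed.

End signed_jump_integral.

(** * Moments of the Lévy measure *)

Section levy_measure_moments.
Local Open Scope ereal_scope.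
Context (R : realType) (F : {measure set R -> \bar R}).
Hypothesis Fmin : \int[F]_x (Num.min 1 (x ^+ 2))%:E < +oo.

Let mmin : measurable_fun setT (fun x : R => (Num.min 1 (x ^+ 2))%:E).
Proof.
by apply/measurable_EFinP; apply: measurable_minr => //; exact: measurable_funX.
Qed.

Let min_ge0 (x : R) : 0 <= (Num.min 1 (x ^+ 2))%:E.
Proof. by rewrite lee_fin le_min ler01 sqr_ge0. Qed.

Lemma measurable_norm_gt (e : R) : measurable [set x : R | (e < `|x|)%R].
Proof. by apply: measurable_set_lt => //; exact: measurableT_comp. Qed.

Lemma measurable_norm_le (e : R) : measurable [set x : R | (`|x| <= e)%R].
Proof. by apply: measurable_set_le => //; exact: measurableT_comp. Qed.

Lemma measurable_annulus (e : R) : measurable [set x : R | (e < `|x| <= 1)%R].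
Proof.
rewrite (_ : [set x | _] = [set x : R | (e < `|x|)%R] `&` [set x : R | (`|x| <= 1)%R]).
  by apply: measurableI; [exact: measurable_norm_gt|exact: measurable_norm_le].
by apply/seteqP; split => x /=; [move/andP|case=> -> ->].
Qed.

Lemma big_jump_rate_finite : F [set x | (1 < `|x|)%R] < +oo.
Proof.
apply: le_lt_trans Fmin; rewrite -[leLHS]mul1e -integral_cst; last exact: measurable_norm_gt.
apply: (@le_trans _ _ (\int[F]_(x in [set x : R | (1 < `|x|)%R]) (Num.min 1 (x ^+ 2))%:E)).
  apply: ge0_le_integral => //; first exact: measurable_norm_gt.
  - exact: measurable_funTS.
  - move=> x /= x1; rewrite lee_fin le_min lexx/= -(real_normK (num_real x)).
    by rewrite exprn_ege1// ltW.
by apply: ge0_subset_integral => //; exact: measurable_norm_gt.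
Qed.

Lemma small_jump_variance_finite :
  \int[F]_(x in [set x | (`|x| <= 1)%R]) (x ^+ 2)%:E < +oo.
Proof.
apply: le_lt_trans Fmin.
apply: (@le_trans _ _ (\int[F]_(x in [set x : R | (`|x| <= 1)%R]) (Num.min 1 (x ^+ 2))%:E)).
  apply: ge0_le_integral => //; first exact: measurable_norm_le.
  - by move=> x _; rewrite lee_fin sqr_ge0.
  - by apply/measurable_EFinP; exact: measurable_funX.
  - exact: measurable_funTS.
  - move=> x /= x1; rewrite lee_fin le_min lexx andbT -(real_normK (num_real x)).
    by rewrite exprn_ile1.
by apply: ge0_subset_integral => //; exact: measurable_norm_le.
Qed.

(** On the annulus |x| <= x^2 / e, and x^2 is integrable there. *)
Lemma annulus_mean_finite (e : R) (h : R -> R) : (0 < e)%R ->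
  measurable_fun setT h -> (forall x, (0 <= h x <= `|x|)%R) ->
  exists a, \int[F]_(x in [set x | (e < `|x| <= 1)%R]) (h x)%:E = a%:E.
Proof.
move=> e0 mh h0.
have mA := measurable_annulus e.
have hge0 : 0 <= \int[F]_(x in [set x | (e < `|x| <= 1)%R]) (h x)%:E.
  by apply: integral_ge0 => x _; rewrite lee_fin; case/andP: (h0 x).
have hlt : \int[F]_(x in [set x | (e < `|x| <= 1)%R]) (h x)%:E < +oo.
  apply: (@le_lt_trans _ _ ((e^-1)%:E *
    \int[F]_(x in [set x | (`|x| <= 1)%R]) (x ^+ 2)%:E)); last first.
    by rewrite lte_mul_pinfty// ?lee_fin ?invr_ge0 ?ltW// small_jump_variance_finite.
  rewrite -ge0_integralZl_EFin; last 4 first.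
  - exact: measurable_norm_le.
  - by move=> x _; rewrite lee_fin sqr_ge0.
  - by apply/measurable_EFinP; exact: measurable_funX.
  - by rewrite invr_ge0 ltW.
  have mg : measurable_fun setT (fun x : R => (e^-1)%:E * (x ^+ 2)%:E).
    by apply: measurable_funeM; apply/measurable_EFinP; exact: measurable_funX.
  have g0 (x : R) : 0 <= (e^-1)%:E * (x ^+ 2)%:E.
    by rewrite -EFinM lee_fin mulr_ge0 ?sqr_ge0 ?invr_ge0 ?ltW.
  apply: (@le_trans _ _ (\int[F]_(x in [set x | (e < `|x| <= 1)%R])
      ((e^-1)%:E * (x ^+ 2)%:E))).
    apply: ge0_le_integral => //.
    - by move=> x _; rewrite lee_fin; case/andP: (h0 x).
    - by apply/measurable_EFinP; exact: measurable_funTS.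
    - exact: measurable_funTS.
    - move=> x /= /andP[ex _]; rewrite -EFinM lee_fin mulrC ler_pdivlMr//.
      have [hx0 hx] := andP (h0 x).
      rewrite -(real_normK (num_real x)) expr2.
      by apply: ler_pM => //; exact: ltW.
  apply: ge0_subset_integral => //; first exact: measurable_norm_le.
  - exact: measurable_funTS.
  - by move=> x /= /andP[].
by exists (fine (\int[F]_(x in [set x | (e < `|x| <= 1)%R]) (h x)%:E));
  rewrite fineK// ge0_fin_numE.
Qed.

End levy_measure_moments.

Lemma funrpos_id_bound (R : realType) (x : R) : 0 <= funrpos id x <= `|x|.
Proof. by rewrite funrpos_ge0 ge_max ler_norm normr_ge0. Qed.

Lemma funrneg_id_bound (R : realType) (x : R) : 0 <= funrneg id x <= `|x|.
Proof. by rewrite funrneg_ge0 ge_max -normrN ler_norm normr_ge0. Qed.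

(** The truncated integrals have second moments at most 2 t v uniformly in the truncation level; M_t
    is their L2 limit, and splitting M_t into approximation and error doubles the bound. *)
Lemma compensated_second_moment d (T : measurableType d) (R : realType)
    (P : probability T R) (X : R -> T -> R) (F : {measure set R -> \bar R})
    (M : R -> T -> R) (t : R) :
  poisson_random_measure P
    (fun w => jump_measure (X ^~ w)) (jump_intensity F) ->
  (\int[F]_x (Num.min 1 (x ^+ 2))%:E < +oo)%E ->
  compensated_small_jumps P X F M -> 0 <= t ->
  (\int[P]_w (M t w ^+ 2)%:E <=
   (4 * t)%:E * \int[F]_(x in [set x | (`|x| <= 1)%R]) (x ^+ 2)%:E)%E.
Proof.
move=> HN Fmin HM t0.
set v := (\int[F]_(x in [set x | (`|x| <= 1)%R]) (x ^+ 2)%:E)%E.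
have v0 : (0 <= v)%E by apply: integral_ge0 => x _; rewrite lee_fin sqr_ge0.
pose V e w := truncated_compensated_jumps X F e t w.
have VE e : 0 < e -> measurable_fun setT (V e) /\
    (\int[P]_w (V e w ^+ 2)%:E <= (2 * t)%:E * v)%E.
  move=> e0; have mA := measurable_annulus e.
  have [a ga] := annulus_mean_finite Fmin e0
    (measurable_funrpos (@measurable_id _ R setT)) (@funrpos_id_bound R).
  have [b gb] := annulus_mean_finite Fmin e0
    (measurable_funrneg (@measurable_id _ R setT)) (@funrneg_id_bound R).
  (* The compensator is exactly the mean of the truncated jump integral, so the truncated process is
     a centered jump integral. *)
  have cE : \int[lebesgue_measure]_(s in `]0%R, t])
      \int[F]_(x in [set x | e < `|x| <= 1]) x = t * (a - b).
    rewrite Rintegral_cst//= lebesgue_measure_itv/= lte_fin.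
    rewrite /Rintegral integral_pos_neg ga gb fineB// mulrC; congr (_ * _).
    move: t0; rewrite le_eqVlt => /predU1P[<-|->]; first by rewrite ltxx.
    by rewrite sube0.
  rewrite /V /truncated_compensated_jumps cE; split.
    by apply: measurable_funB => //; exact: (measurable_signed_jump_integral HN).
  apply: (le_trans (jump_integral_second_moment HN mA _ t0 ga gb)) => //.
  rewrite lee_wpmul2l// ?lee_fin ?mulr_ge0//.
  apply: ge0_subset_integral => //.
  - exact: measurable_norm_le.
  - by apply/measurable_EFinP; exact: measurable_funX.
  - by move=> x _; rewrite lee_fin sqr_ge0.
  - by move=> x /= /andP[].
have mM := compensated_measurable HM t0.
have tv0 : (0 <= (4 * t)%:E * v)%E by rewrite mule_ge0// lee_fin mulr_ge0.
apply/lee_addgt0Pr => r r0.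
have r20 : (0%:E < (r / 2)%:E)%E by rewrite lte_fin divr_gt0.
have := compensated_cvg HM t0.
move=> /(_ _ (open_ereal_lt' r20)) [e /= e0 He].
have e20 : 0 < e / 2 by rewrite divr_gt0.
have {He} : (\int[P]_w ((V (e / 2) w - M t w) ^+ 2)%:E < (r / 2)%:E)%E.
  apply: He => //=; rewrite sub0r normrN gtr0_norm//; lra.
have [mV HV] := VE _ e20; move=> HVM.
rewrite (_ : (fun w => (M t w ^+ 2)%:E) =
    (fun w => ((V (e / 2) w + (M t w - V (e / 2) w)) ^+ 2)%:E)); last first.
  by apply/funext => w; rewrite addrCA subrr addr0.
apply: (le_trans (second_momentD P mV (measurable_funB mM mV))).
apply: leeD.
  rewrite (_ : (4 * t)%:E = (2 * (2 * t))%:E); last by congr EFin; ring.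
  by rewrite EFinM -muleA lee_wpmul2l.
rewrite (_ : r%:E = 2%:E * (r / 2)%:E)%E; last by rewrite -EFinM; congr EFin; field.
rewrite lee_wpmul2l// ltW// (le_lt_trans _ HVM)//.
rewrite le_eqVlt; apply/orP; left; apply/eqP; apply: eq_integral => w _.
by rewrite -sqrrN opprB.
Qed.

(** * Integrability of the big jumps *)

Section big_jumps_integrable.
Local Open Scope ereal_scope.
Context d (T : measurableType d) (R : realType) (P : probability T R).
Variables (X : R -> T -> R) (F : {measure set R -> \bar R}).
Hypothesis HN : poisson_random_measure P
  (fun w => jump_measure (X ^~ w)) (jump_intensity F).
Variable D : set R.
Hypothesis mD : measurable D.
Hypothesis FD : F D < +oo.

Let K (w : T) : {measure set R -> \bar R} := jumps_upto (X ^~ w) 1.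

Let F1 : {measure set R -> \bar R} := mscale (NngNum (@ler01 R)) F.

Let HK : poisson_random_measure P (fun w A => K w A) F1.
Proof. exact: prm_jumps_upto HN. Qed.

Let F1E A : F1 A = F A.
Proof. by rewrite /F1/= /mscale/= mul1e. Qed.

Let integral_F1 (h : R -> \bar R) : \int[F1]_x h x = \int[F]_x h x.
Proof. by apply: eq_measure_integral => A _ _; exact: F1E. Qed.

Section one_side.
(* [u] and [v] stand for the positive and negative parts, in either order. *)
Variables u v : R -> R.
Hypothesis mu_ : measurable_fun setT u.
Hypothesis mv : measurable_fun setT v.
Hypothesis u0 : forall x, (0 <= u x)%R.
Hypothesis v0 : forall x, (0 <= v x)%R.
Hypothesis uv : forall x, (0 < u x)%R -> v x = 0%R.

Let A n := D `&` [set x | (0 < u x)%R] `&` [set x | (u x <= n%:R)%R].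

Let mA n : measurable (A n).
Proof.
apply: measurableI; last exact: measurable_set_le.
by apply: measurableI => //; exact: measurable_set_lt.
Qed.

(** The jumps to be excluded: those with [u] above n and those where [u] vanishes, in particular
    those of the opposite sign. *)
Let C n := D `\` A n.

Let mC n : measurable (C n).
Proof. exact: measurableD. Qed.

Let h n x : R := (u x * \1_(A n) x)%R.

Let mh n : measurable_fun setT (h n).
Proof. by apply: measurable_funM => //; exact: measurable_indic. Qed.

Let h0 n x : (0 <= h n x)%R.
Proof. by rewrite mulr_ge0. Qed.

Let hE n (m : {measure set R -> \bar R}) :
  \int[m]_x (h n x)%:E = \int[m]_(x in A n) (u x)%:E.
Proof.
rewrite [RHS]integral_mkcond; apply: eq_integral => x _.
by rewrite patchE /h indicE; case: ifPn => _; rewrite ?mulr1 ?mulr0.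
Qed.

Let hfin n : \int[F]_x (h n x)%:E < +oo.
Proof.
rewrite hE (@le_lt_trans _ _ (n%:R%:E * F D))//.
  apply: (@le_trans _ _ (n%:R%:E * F (A n))).
    rewrite -integral_cst//; apply: ge0_le_integral => //.
    - by move=> x _; rewrite lee_fin.
    - by apply/measurable_EFinP; exact: measurable_funTS.
    - by move=> x [_ ux]; rewrite lee_fin.
  rewrite lee_wpmul2l// ?lee_fin// le_measure ?inE//.
  by move=> x [[]].
by rewrite lte_mul_pinfty// lee_fin.
Qed.

Let void_integrals n w : K w (C n) = 0 ->
  \int[K w]_(x in D) (u x)%:E = \int[K w]_x (h n x)%:E /\
  \int[K w]_(x in D) (v x)%:E = 0.
Proof.
move=> KC; have DC : D `\` C n = A n.
  by rewrite /C setDD; apply: setIidr => x [[]].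
split.
  rewrite (ge0_negligible_integral (mC n) mD) ?DC ?hE//.
  - by apply/measurable_EFinP; exact: measurable_funTS.
  - by move=> x _; rewrite lee_fin.
rewrite (ge0_negligible_integral (mC n) mD) ?DC//; last 2 first.
- by apply/measurable_EFinP; exact: measurable_funTS.
- by move=> x _; rewrite lee_fin.
by rewrite integral0_eq// => x [[_ /= ux] _]; rewrite uv.
Qed.

(** When [C n] is void, [G] dominates the sum of the jumps in [A n]; taking means gives exp(-F(C n))
    times the integral of [u] over [A n] at most c. As F(C n) <= F(D), the bound is uniform in n.
    The comparison with [G] is asked only where the jump integral has one sign and is finite. *)
Lemma big_jumps_one_side (G : T -> R) (c : R) :
  measurable_fun setT G -> (forall w, (0 <= G w)%R) ->
  \int[P]_w (G w)%:E <= c%:E ->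
  {ae P, forall w, \int[K w]_(x in D) (v x)%:E = 0 ->
    \int[K w]_(x in D) (u x)%:E \is a fin_num ->
    \int[K w]_(x in D) (u x)%:E <= (G w)%:E} ->
  \int[F]_(x in D) (u x)%:E < +oo.
Proof.
move=> mG G0 Gc HG.
have bound n : \int[F]_(x in A n) (u x)%:E <= (expR (fine (F D)) * c)%:E.
  have Coo : F (C n) < +oo.
    by rewrite (le_lt_trans _ FD)// le_measure ?inE// => x [].
  have mhE : measurable_fun setT (EFin \o h n) by exact/measurable_EFinP.
  have h0E x : 0 <= (EFin \o h n) x by rewrite lee_fin.
  have hC x : C n x -> (EFin \o h n) x = 0.
    by move=> [_ nA]; rewrite /= /h indicE memNset// mulr0.
  have := prm_integral_void HK (mC n) _ mhE h0E hC.
  rewrite F1E integral_F1 hE => /(_ Coo) HE.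
  have mhit : measurable [set w | K w (C n) = 0].
    rewrite -[X in measurable X]setTI.
    by have := prm_measurable HK (mC n) measurableT (emeasurable_set1 0%:E); exact.
  have : (expR (- fine (F (C n))))%:E * \int[F]_(x in A n) (u x)%:E <= c%:E.
    rewrite -HE; apply: le_trans Gc.
    apply: ae_ge0_le_integral => //.
    - by move=> w _; rewrite mule_ge0// ?lee_fin// integral_ge0.
    - apply: emeasurable_funM.
        by apply/measurable_EFinP; exact: measurable_indic.
      exact: (measurable_prm_integral HK).
    - by move=> w _; rewrite lee_fin.
    - exact/measurable_EFinP.
    have hK := prm_integral_fin_num HK mhE h0E.
    rewrite integral_F1 in hK.
    apply: filterS2 HG (hK (hfin n)) => w Hw hw _.
    rewrite indicE; have [|_] := boolP (w \in _); last by rewrite mul0e lee_fin.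
    rewrite inE /= => /void_integrals[uE vE]; rewrite mul1e -uE.
    by apply: Hw => //; rewrite uE.
  have e0 : (0 < expR (- fine (F (C n))))%R by rewrite expR_gt0.
  rewrite -lee_pdivlMl// => /le_trans; apply.
  rewrite -EFinM lee_fin -expRN opprK ler_wpM2r//.
    have : 0 <= c%:E by apply: le_trans Gc; apply: integral_ge0 => w _; rewrite lee_fin.
    by rewrite lee_fin.
  rewrite ler_expR fine_le//.
  - by rewrite ge0_fin_numE.
  - by rewrite ge0_fin_numE.
  - by rewrite le_measure ?inE// => x [].
apply: (@le_lt_trans _ _ (expR (fine (F D)) * c)%:E); last by rewrite ltry.
have muE : measurable_fun setT (EFin \o u) by exact/measurable_EFinP.
have ndA : nondecreasing_seq A.
  apply/nondecreasing_seqP => n; apply/subsetPset => x [[Dx ux] /= un].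
  by split => //=; rewrite (le_trans un)// ler_nat.
have cvgA : \int[F]_(x in A n) (u x)%:E @[n --> \oo] -->
    \int[F]_(x in \bigcup_n A n) (u x)%:E.
  apply: ge0_nondecreasing_set_cvg_integral => //.
  - by move=> n; exact: measurable_funTS.
  - by move=> n x _; rewrite lee_fin.
have AU : \bigcup_n A n = D `&` [set x | (0 < u x)%R].
  apply/seteqP; split => x; first by move=> [n _ []].
  move=> Dx; exists (Num.trunc (u x)).+1 => //; split => //=.
  by rewrite ltW// truncnS_gt.
have -> : \int[F]_(x in D) (u x)%:E = \int[F]_(x in \bigcup_n A n) (u x)%:E.
  rewrite AU integral_mkcondr; apply: eq_integral => x _.
  rewrite patchE; case: ifPn => //; rewrite notin_setE/= => /negP.
  by rewrite -leNgt => ux; congr EFin; apply/eqP; rewrite eq_le ux u0.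
rewrite -(cvg_lim _ cvgA)//; apply: lime_le; last exact: nearW.
apply: ereal_nondecreasing_is_cvgn.
apply: ge0_nondecreasing_set_nondecreasing_integral => // n.
  exact: measurable_funTS.
by move=> x _; rewrite lee_fin.
Qed.

End one_side.

End big_jumps_integrable.

(** * Integrability of the logarithmic jumps *)

Section log_jump_bounds.
Context (R : realType) (f : R).
Hypothesis f01 : 0 <= f <= 1.
Implicit Type x : R.

Let f0 : 0 <= f. Proof. by case/andP: f01. Qed.
Let f1 : f <= 1. Proof. by case/andP: f01. Qed.

(* Weighted AM-GM, by the tangent line inequality for exp at [f * x]. *)
Lemma expR_mix_ge x : expR (f * x) <= 1 + f * (expR x - 1).
Proof.
set a := f * x.
have ex : expR x = expR a * expR (x - a) by rewrite -expRD addrC subrK.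
have e1 : expR a * expR (- a) = 1 by rewrite expRN divff// gt_eqF// expR_gt0.
have h1 : f * (expR a * (1 + (x - a))) <= f * (expR a * expR (x - a)).
  by rewrite ler_wpM2l// ler_wpM2l ?expR_ge0// expR_ge1Dx.
have h2 : (1 - f) * (expR a * (1 - a)) <= (1 - f) * (expR a * expR (- a)).
  by rewrite ler_wpM2l ?subr_ge0// ler_wpM2l ?expR_ge0// expR_ge1Dx.
move: h1 h2; rewrite -ex e1.
have -> : f * (expR a * (1 + (x - a))) =
  expR a - (1 - f) * (expR a * (1 - a)) + expR a * (f * x - a) by ring.
by rewrite subrr mulr0 addr0; lra.
Qed.

Lemma mix_gt0 x : 0 < 1 + f * (expR x - 1).
Proof. exact: lt_le_trans (expR_gt0 _) (expR_mix_ge x). Qed.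

Lemma log_jump_ge0 x : 0 <= log_jump f x.
Proof.
rewrite /log_jump subr_ge0 -[leLHS]expRK ler_ln ?posrE ?expR_gt0 ?mix_gt0//.
exact: expR_mix_ge.
Qed.

Lemma log_jump_le_linear x : log_jump f x <= 2 * `|x|.
Proof.
have H : ln (1 + f * (expR x - 1)) <= `|x|.
  rewrite -[leRHS]expRK ler_ln ?posrE ?expR_gt0 ?mix_gt0//.
  have e1 : f * expR x <= f * expR `|x| by rewrite ler_wpM2l// ler_expR ler_norm.
  have e2 : (1 - f) * 1 <= (1 - f) * expR `|x|.
    by rewrite ler_wpM2l ?subr_ge0// -[leLHS]expR0 ler_expR.
  lra.
have fx : - (f * x) <= `|x|.
  rewrite (le_trans (ler_norm _))// normrN normrM ger0_norm//.
  by rewrite -[leRHS]mul1r ler_wpM2r.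
rewrite /log_jump; lra.
Qed.

(** From ln(1 + y) <= y, the function is at most f (e^x - 1 - x). For |x| <= 1/2, the bound e^x (1 -
    x) <= 1 gives (e^x - 1 - x)(1 - x) <= x^2, and dividing by 1 - x >= 1/2 costs a factor 2. For
    |x| > 1/2 the linear bound suffices, as |x| <= 2 x^2. *)
Lemma log_jump_le_quadratic x : log_jump f x <= 4 * x ^+ 2.
Proof.
have x2 : x ^+ 2 = `|x| * `|x| by rewrite -(real_normK (num_real x)) expr2.
have [xs|xl] := leP `|x| 2^-1; last first.
  apply: (le_trans (log_jump_le_linear x)); rewrite x2.
  have : 2^-1 * `|x| <= `|x| * `|x| by rewrite ler_wpM2r// ltW.
  lra.
have lnle : ln (1 + f * (expR x - 1)) <= f * (expR x - 1).
  by rewrite -[leRHS]expRK ler_ln ?posrE ?expR_gt0 ?mix_gt0// expR_ge1Dx.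
have x12 : x <= 2^-1 := le_trans (ler_norm x) xs.
have y0 : 0 < 1 - x by lra.
have ex : expR x * (1 - x) <= 1.
  have e1 : expR x * expR (- x) = 1 by rewrite expRN divff// gt_eqF// expR_gt0.
  by rewrite -[leRHS]e1 ler_wpM2l ?expR_ge0// expR_ge1Dx.
have q : expR x - 1 - x <= 2 * x ^+ 2.
  have h : (expR x - 1 - x) * (1 - x) <= x ^+ 2 by move: ex; rewrite expr2; lra.
  have b0 : 0 <= expR x - 1 - x by have := expR_ge1Dx x; lra.
  have : (expR x - 1 - x) * 2^-1 <= (expR x - 1 - x) * (1 - x).
    by rewrite ler_wpM2l//; lra.
  lra.
have fq : f * (expR x - 1 - x) <= 1 * (2 * x ^+ 2).
  by apply: ler_pM => //; have := expR_ge1Dx x; lra.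
rewrite /log_jump; have := sqr_ge0 x; lra.
Qed.

Lemma measurable_log_jump : measurable_fun setT (log_jump f).
Proof.
apply: measurable_funB; last exact: measurable_funM.
apply: measurableT_comp; first exact: measurable_ln.
by apply: measurable_funD => //; apply: measurable_funM => //; exact: measurable_funB.
Qed.

Lemma log_jump_integrable (F : {measure set R -> \bar R}) :
  (\int[F]_(x in [set x | (`|x| <= 1)%R]) (x ^+ 2)%:E < +oo)%E ->
  (\int[F]_(x in [set x | (1 < `|x|)%R]) (`|x|%R)%:E < +oo)%E ->
  (\int[F]_(x in ~` [set 0%R]) (log_jump f x)%:E < +oo)%E.
Proof.
move=> small big.
have mE : measurable_fun setT (EFin \o log_jump f).
  by apply/measurable_EFinP; exact: measurable_log_jump.
have ge0 x : (0 <= (log_jump f x)%:E)%E by rewrite lee_fin log_jump_ge0.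
have ms := @measurable_norm_le R 1; have ml := @measurable_norm_gt R 1.
apply: (@le_lt_trans _ _ (\int[F]_x (log_jump f x)%:E)%E).
  by apply: ge0_subset_integral => //; apply: measurableC.
have -> : [set: R] = [set x : R | `|x| <= 1] `|` [set x : R | 1 < `|x|].
  by apply/seteqP; split => // x _ /=; have [|] := leP `|x| 1; [left|right].
rewrite ge0_integral_setU//; last 2 first.
- exact: measurable_funTS.
- rewrite disj_set2E; apply/eqP/seteqP; split => // x [/= x1].
  by rewrite ltNge x1.
rewrite lte_add_pinfty//.
- apply: (@le_lt_trans _ _ (4%:E * \int[F]_(x in [set x | (`|x| <= 1)%R]) (x ^+ 2)%:E)%E).
    rewrite -ge0_integralZl_EFin//; last 2 first.
    + by move=> x _; rewrite lee_fin sqr_ge0.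
    + by apply/measurable_EFinP; exact: measurable_funX.
    apply: ge0_le_integral => //.
    + exact: measurable_funTS.
    + by apply: measurable_funeM; apply/measurable_EFinP; exact: measurable_funX.
    + by move=> x _; rewrite -EFinM lee_fin log_jump_le_quadratic.
  by rewrite lte_mul_pinfty.
- apply: (@le_lt_trans _ _ (2%:E * \int[F]_(x in [set x | (1 < `|x|)%R]) (`|x|%R)%:E)%E).
    rewrite -ge0_integralZl_EFin//; last first.
      by apply/measurable_EFinP; exact: normr_measurable.
    apply: ge0_le_integral => //.
    + exact: measurable_funTS.
    + by apply: measurable_funeM; apply/measurable_EFinP; exact: normr_measurable.
    + by move=> x _; rewrite -EFinM lee_fin log_jump_le_linear.
  by rewrite lte_mul_pinfty.
Qed.

End log_jump_bounds.

(** * Averages of the process *)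

Lemma ae_le_measure d (T : measurableType d) (R : realType)
    (P : {measure set T -> \bar R}) (A B : set T) :
  measurable A -> measurable B -> {ae P, forall w, A w -> B w} -> (P A <= P B)%E.
Proof.
move=> mA mB [N [mN N0 HN]].
apply: (@le_trans _ _ (P (B `|` N))).
  apply: le_measure; rewrite ?inE//; first exact: measurableU.
  move=> w Aw; have [Bw|nB] := pselect (B w); [by left|right].
  by apply: HN => /= AB; apply: nB; exact: AB.
apply: (le_trans (measureU2 P mB mN)).
by rewrite [X in (_ + X <= _)%E]N0 adde0.
Qed.

Lemma summable_halves (R : realType) (C : R) : 0 <= C ->
  (\sum_(k <oo) (C / 2 ^+ k)%:E < +oo)%E.
Proof.
move=> C0; apply: (@le_lt_trans _ _ (C * 2)%:E); last by rewrite ltry.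
apply: lime_le.
  by apply: is_cvg_nneseries => k _ _; rewrite lee_fin divr_ge0// exprn_ge0.
apply: nearW => n; rewrite sumEFin lee_fin big_mkord -mulr_sumr ler_wpM2l//.
have q1 : 1 < 2 :> R by rewrite ltr1n.
(* With u = 1 every scale 2^k counts, and the sum is the plain geometric series. *)
have := sum_pow_above n q1 (@ler01 R); rewrite (_ : 2 - 1 = 1 :> R); last by ring.
rewrite divr1 mulr1; apply: le_trans; apply: ler_sum => k _.
by rewrite expr1n mul1r exprn_ege1 ?mulr1// ltW.
Qed.

Lemma chebyshev_power_scale d (T : measurableType d) (R : realType)
    (P : probability T R) (Y : T -> R) (C e : R) (k : nat) :
  measurable_fun setT Y -> 0 < e ->
  (\int[P]_w (Y w ^+ 2)%:E <= (C * 2 ^+ k)%:E)%E ->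
  (P [set w | (e * 2 ^+ k < `|Y w|)%R] <= (C / e ^+ 2 / 2 ^+ k)%:E)%E.
Proof.
move=> mY e0 HY; have p0 : 0 < 2 ^+ k :> R by rewrite exprn_gt0.
have c0 : 0 < e * 2 ^+ k by rewrite mulr_gt0.
have mnY : measurable_fun setT (fun w => `|Y w|) by exact: measurableT_comp.
apply: (@le_trans _ _ (P [set w | e * 2 ^+ k <= `|Y w|])).
  apply: le_measure; rewrite ?inE.
  - exact: measurable_set_lt.
  - exact: measurable_set_le.
  - by move=> w /= /ltW.
apply: (le_trans (chebyshev_second_moment P mY c0)).
apply: (le_trans (lee_wpmul2l _ HY)); first by rewrite lee_fin invr_ge0 sqr_ge0.
rewrite -EFinM lee_fin le_eqVlt; apply/orP; left; apply/eqP; field.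
by rewrite !gt_eqF.
Qed.

Section levy_ito_process.
Context (R : realType) (d : measure_display) (T : measurableType d).
Variables (P : probability T R) (X B M : R -> T -> R).
Variables (F : {measure set R -> \bar R}) (mu sigma : R).
Hypothesis X_levy : levy_process P X.
Hypothesis F_levy : levy_measure P X F.
Hypothesis B_brownian : standard_brownian_motion P B.
Hypothesis HN : poisson_random_measure P
  (fun w => jump_measure (X ^~ w)) (jump_intensity F).
Hypothesis M_compensated : compensated_small_jumps P X F M.
Let D : set R := [set x | 1 < `|x|].
Hypothesis XE : {ae P, forall w, forall t : R, 0 <= t ->
  X t w = mu * t + sigma * B t w + M t w + jump_integral X D id t w}.
Hypothesis X1_integrable : ('E_P[(fun w => `|X 1 w|)%R] < +oo)%E.

Let mX (t : R) : 0 <= t -> measurable_fun setT (X t).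
Proof. by move=> t0; exact: (levy_measurable X_levy t0). Qed.

Let mB (t : R) : 0 <= t -> measurable_fun setT (B t).
Proof. by move=> t0; exact: (brownian_measurable B_brownian t0). Qed.

Let mM (t : R) : 0 <= t -> measurable_fun setT (M t).
Proof. by move=> t0; exact: (compensated_measurable M_compensated t0). Qed.

Let mD : measurable D.
Proof. exact: measurable_norm_gt. Qed.

Let mid : measurable_fun setT (@id R).
Proof. exact: measurable_id. Qed.

Let Fmin := levy_measure_integrable F_levy.

Let first_moment_bound (Y : T -> R) : measurable_fun setT Y ->
  (\int[P]_w (Y w ^+ 2)%:E < +oo)%E -> (\int[P]_w (`|Y w|)%:E < +oo)%E.
Proof.
move=> mY Yoo; apply: (@le_lt_trans _ _ (\int[P]_w (1%:E + (Y w ^+ 2)%:E))%E).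
  apply: ge0_le_integral => //.
  - by apply/measurable_EFinP; exact: measurableT_comp.
  - apply: emeasurable_funD => //; apply/measurable_EFinP; exact: measurable_funX.
  - move=> w _; rewrite -EFinD lee_fin -(real_normK (num_real (Y w))).
    have := sqr_ge0 (`|Y w| - 1); rewrite sqrrB; have := normr_ge0 (Y w); lra.
have mY2 : measurable_fun setT (fun w => (Y w ^+ 2)%:E).
  by apply/measurable_EFinP; exact: measurable_funX.
have Y20 w : (0 <= (Y w ^+ 2)%:E)%E by rewrite lee_fin sqr_ge0.
rewrite ge0_integralD//.
by rewrite integral_cst//= probability_setT mule1 lte_add_pinfty// ltry.
Qed.

Let moment_M : exists2 C, 0 <= C &
  forall s t, 0 <= s -> s <= t -> (\int[P]_w (M s w ^+ 2)%:E <= (C * t)%:E)%E.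
Proof.
have v_oo := small_jump_variance_finite Fmin.
set v := integral _ _ _ in v_oo.
have v0 : (0 <= v)%E by apply: integral_ge0 => x _; rewrite lee_fin sqr_ge0.
have vE : v = (fine v)%:E by rewrite fineK// ge0_fin_numE.
exists (4 * fine v); first by rewrite mulr_ge0// fine_ge0.
move=> s t s0 st; apply: (le_trans (compensated_second_moment HN Fmin M_compensated s0)).
rewrite -/v vE -EFinM lee_fin mulrAC ler_wpM2l ?mulr_ge0 ?fine_ge0//.
Qed.

Lemma big_jump_parts_finite : exists ab : R * R,
  (\int[F]_(x in D) (funrpos id x)%:E = ab.1%:E)%E /\
  (\int[F]_(x in D) (funrneg id x)%:E = ab.2%:E)%E.
Proof.
(* Solving the decomposition at time 1 for the big-jump integral bounds it by [G], which is
   integrable: X by hypothesis, B and M through their second moments. *)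
pose G w : R := `|X 1 w| + `|mu| + `|sigma| * `|B 1 w| + `|M 1 w|.
have mG : measurable_fun setT G.
  apply: measurable_funD; last by apply: measurableT_comp => //; exact: mM.
  apply: measurable_funD.
    by apply: measurable_funD => //; apply: measurableT_comp => //; exact: mX.
  by apply: measurable_funM => //; apply: measurableT_comp => //; exact: mB.
have G0 w : 0 <= G w by rewrite !addr_ge0// mulr_ge0.
have [c Gc] : exists c : R, (\int[P]_w (G w)%:E <= c%:E)%E.
  have Goo : (\int[P]_w (G w)%:E < +oo)%E.
    have mn (Y : T -> R) : measurable_fun setT Y ->
        measurable_fun setT (fun w => (`|Y w|)%:E).
      by move=> mY; apply/measurable_EFinP; exact: measurableT_comp.
    have Boo : (\int[P]_w (`|B 1 w|)%:E < +oo)%E.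
      apply: first_moment_bound; first exact: mB.
      by rewrite (le_lt_trans (brownian_second_moment B_brownian ler01))// ltry.
    have Moo : (\int[P]_w (`|M 1 w|)%:E < +oo)%E.
      apply: first_moment_bound; first exact: mM.
      have [C _ HC] := moment_M.
      by rewrite (le_lt_trans (HC 1 1 ler01 (lexx _)))// ltry.
    have Xoo : (\int[P]_w (`|X 1 w|)%:E < +oo)%E.
      by move: X1_integrable; rewrite unlock.
    have mX1 := mn _ (mX ler01); have mB1 := mn _ (mB ler01).
    have mM1 := mn _ (mM ler01).
    have n0 (Y : T -> R) w : (0 <= (`|Y w|)%:E)%E by rewrite lee_fin.
    rewrite (eq_integral (fun w => (`|X 1 w|)%:E + (`|mu|%:E +
      (`|sigma|%:E * (`|B 1 w|)%:E + (`|M 1 w|)%:E)))%E); last first.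
      by move=> w _; rewrite /G !EFinD EFinM !addeA.
    have sB0 w : (0 <= `|sigma|%:E * (`|B 1 w|)%:E)%E by rewrite mule_ge0// lee_fin.
    have msB : measurable_fun setT (fun w => `|sigma|%:E * (`|B 1 w|)%:E)%E.
      exact: measurable_funeM.
    have h1 w : (0 <= `|sigma|%:E * (`|B 1 w|)%:E + (`|M 1 w|)%:E)%E.
      by rewrite adde_ge0.
    have h2 w : (0 <= `|mu|%:E + (`|sigma|%:E * (`|B 1 w|)%:E + (`|M 1 w|)%:E))%E.
      by rewrite adde_ge0// lee_fin.
    have m1 : measurable_fun setT
        (fun w => `|sigma|%:E * (`|B 1 w|)%:E + (`|M 1 w|)%:E)%E.
      exact: emeasurable_funD.
    have m2 : measurable_fun setT
        (fun w => `|mu|%:E + (`|sigma|%:E * (`|B 1 w|)%:E + (`|M 1 w|)%:E))%E.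
      exact: emeasurable_funD.
    rewrite (ge0_integralD P measurableT (fun w _ => n0 (X 1) w) mX1 (fun w _ => h2 w) m2).
    rewrite (ge0_integralD P measurableT _ _ (fun w _ => h1 w) m1)//.
    rewrite (ge0_integralD P measurableT (fun w _ => sB0 w) msB (fun w _ => n0 (M 1) w) mM1).
    rewrite ge0_integralZl_EFin//.
    rewrite integral_cst//= probability_setT mule1.
    rewrite lte_add_pinfty// lte_add_pinfty ?ltry// lte_add_pinfty//.
    by rewrite lte_mul_pinfty// lee_fin.
  exists (fine (\int[P]_w (G w)%:E)).
  by rewrite fineK// ge0_fin_numE// integral_ge0// => w _; rewrite lee_fin.
have JE w : jump_integral X D id 1 w =
    fine (\int[jumps_upto (X ^~ w) 1]_(x in D) (funrpos id x)%:E -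
          \int[jumps_upto (X ^~ w) 1]_(x in D) (funrneg id x)%:E)%E.
  by rewrite /jump_integral /Rintegral (integral_jumps_upto _ _ mD mid) integral_pos_neg.
have GJ : {ae P, forall w, `|jump_integral X D id 1 w| <= G w}.
  apply: filterS XE => w /(_ 1 ler01) XwE; rewrite /G XwE mulr1.
  set J := jump_integral _ _ _ _ _.
  set a := sigma * B 1 w; rewrite -normrM -/a.
  have Jsum : J = (mu + a + M 1 w + J) + - mu + - a + - M 1 w by ring.
  rewrite [X in `|X| <= _]Jsum (le_trans (ler_normD _ _))// normrN lerD2r.
  rewrite (le_trans (ler_normD _ _))// normrN lerD2r.
  by rewrite (le_trans (ler_normD _ _))// normrN.
have FD := big_jump_rate_finite Fmin.
have mpos := measurable_funrpos mid; have mneg := measurable_funrneg mid.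
have pos_oo : (\int[F]_(x in D) (funrpos id x)%:E < +oo)%E.
  apply: (big_jumps_one_side HN mD FD mpos mneg
    (funrpos_ge0 id) (funrneg_ge0 id) _ mG G0 Gc).
    by move=> x; rewrite /funrpos /funrneg lt_max ltxx orbF => x0;
      rewrite max_r// oppr_le0 ltW.
  apply: filterS GJ => w; rewrite JE => + n0 pfin.
  rewrite n0 sube0 => H; rewrite -(fineK pfin) lee_fin.
  exact: le_trans (ler_norm _) H.
have neg_oo : (\int[F]_(x in D) (funrneg id x)%:E < +oo)%E.
  apply: (big_jumps_one_side HN mD FD mneg mpos
    (funrneg_ge0 id) (funrpos_ge0 id) _ mG G0 Gc).
    by move=> x; rewrite /funrpos /funrneg lt_max ltxx orbF oppr_gt0 => x0;
      rewrite max_r// ltW.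
  apply: filterS GJ => w; rewrite JE => + p0 nfin.
  rewrite p0 add0e fineN normrN => H; rewrite -(fineK nfin) lee_fin.
  exact: le_trans (ler_norm _) H.
exists (fine (\int[F]_(x in D) (funrpos id x)%:E)%E,
        fine (\int[F]_(x in D) (funrneg id x)%:E)%E).
split; rewrite fineK// ge0_fin_numE// integral_ge0// => x _; rewrite lee_fin.
  exact: funrpos_ge0.
exact: funrneg_ge0.
Qed.

Lemma big_jumps_integrable : (\int[F]_(x in D) (`|x|)%:E < +oo)%E.
Proof.
have [[a b] /= [ga gb]] := big_jump_parts_finite.
rewrite (eq_integral (fun x : R => (funrpos id x)%:E + (funrneg id x)%:E)%E); last first.
  move=> x _; rewrite -EFinD /funrpos /funrneg /=; congr EFin.
  case: (lerP 0 x) => x0; first by rewrite ger0_norm// max_r ?oppr_le0// addr0.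
  by rewrite ltr0_norm// max_l ?oppr_ge0 ?ltW// add0r.
rewrite ge0_integralD//.
- by rewrite [X in (X + _)%E]ga [X in (_ + X)%E]gb -EFinD ltry.
- by move=> x _; rewrite lee_fin funrpos_ge0.
- by apply/measurable_EFinP/measurable_funTS; exact: measurable_funrpos.
- by move=> x _; rewrite lee_fin funrneg_ge0.
- by apply/measurable_EFinP/measurable_funTS; exact: measurable_funrneg.
Qed.

Lemma levy_ito_average : {ae P, forall w,
  X t w / t @[t --> +oo] --> mu + \int[F]_(x in D) x}.
Proof.
have [[a b] /= [ga gb]] := big_jump_parts_finite.
have -> : \int[F]_(x in D) x = a - b.
  by rewrite /Rintegral (@integral_pos_neg R _ _ F D id) [X in (X - _)%E]ga
    [X in (_ - X)%E]gb.
apply: (levy_average X_levy) => e e0.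
have e40 : 0 < e / 4 by rewrite divr_gt0.
have mpos := measurable_funrpos mid; have mneg := measurable_funrneg mid.
have q1 : 1 < 2 :> R by rewrite ltr1n.
have [p1 [p10 p1oo Hp1]] :=
  jump_integral_deviation HN mD mpos (funrpos_ge0 id) ga q1 e40.
have [p2 [p20 p2oo Hp2]] :=
  jump_integral_deviation HN mD mneg (funrneg_ge0 id) gb q1 e40.
have [C C0 HC] := moment_M.
(* The 16 comes from [brownian_second_moment], which bounds the variance only up to a constant. *)
pose CB := 16 * sigma ^+ 2.
have HB k s : 0 <= s -> s <= 2 ^+ k ->
    (\int[P]_w ((sigma * B s w) ^+ 2)%:E <= (CB * 2 ^+ k)%:E)%E.
  move=> s0 sk.
  rewrite (eq_integral (fun w => (sigma ^+ 2)%:E * (B s w ^+ 2)%:E)%E); last first.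
    by move=> w _; rewrite exprMn EFinM.
  rewrite ge0_integralZl_EFin ?sqr_ge0//; last 2 first.
  - by move=> w _; rewrite lee_fin sqr_ge0.
  - by apply/measurable_EFinP; apply: measurable_funX; exact: mB.
  apply: (le_trans (lee_wpmul2l _ (brownian_second_moment B_brownian s0))).
    by rewrite lee_fin sqr_ge0.
  rewrite -EFinM lee_fin /CB.
  have : sigma ^+ 2 * s <= sigma ^+ 2 * 2 ^+ k by rewrite ler_wpM2l// sqr_ge0.
  lra.
pose c (C' : R) k : \bar R := (C' / (e / 4) ^+ 2 / 2 ^+ k)%:E.
have coo C' : 0 <= C' -> (forall k, (0 <= c C' k)%E) /\ (\sum_(k <oo) c C' k < +oo)%E.
  move=> C'0; have C'e : 0 <= C' / (e / 4) ^+ 2 by rewrite divr_ge0// sqr_ge0.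
  split; last exact: summable_halves.
  by move=> k; rewrite lee_fin divr_ge0// exprn_ge0.
have CB0 : 0 <= CB by rewrite mulr_ge0// sqr_ge0.
have [cB0 cBoo] := coo _ CB0; have [cM0 cMoo] := coo _ C0.
exists (fun k => (c CB k + c C k) + (p1 k + p2 k))%E; split.
- by move=> k; rewrite !adde_ge0.
- rewrite nneseriesD; last 2 first.
  + by move=> k _ _; rewrite adde_ge0.
  + by move=> k _ _; rewrite adde_ge0.
  by rewrite !nneseriesD// !lte_add_pinfty.
- move=> k s s0 sk.
  pose A1 := [set w | e / 4 * 2 ^+ k < `|sigma * B s w|].
  pose A2 := [set w | e / 4 * 2 ^+ k < `|M s w|].
  pose A3 := [set w | e / 4 * 2 ^+ k < `|jump_integral X D (funrpos id) s w - s * a|].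
  pose A4 := [set w | e / 4 * 2 ^+ k < `|jump_integral X D (funrneg id) s w - s * b|].
  have mYlt (Y : T -> R) (r : R) : measurable_fun setT Y -> measurable [set w | r < `|Y w|].
    by move=> mY; apply: measurable_set_lt => //; exact: measurableT_comp.
  have mA1 : measurable A1.
    by apply: mYlt; apply: measurable_funM => //; exact: mB.
  have mA2 : measurable A2 by apply: mYlt; exact: mM.
  have mA3 : measurable A3.
    by apply: mYlt; apply: measurable_funB => //; exact: (measurable_signed_jump_integral HN).
  have mA4 : measurable A4.
    by apply: mYlt; apply: measurable_funB => //; exact: (measurable_signed_jump_integral HN).
  (* A deviation above e 2^k forces one of the four parts above a quarter of it. The inclusion is
     almost sure, like the decomposition; the centering cancels mu s exactly and leaves (a - b) s to
     the big jumps. *)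
  apply: (@le_trans _ _ (P ((A1 `|` A2) `|` (A3 `|` A4)))).
    apply: ae_le_measure.
    + by apply: mYlt; apply: measurable_funB => //; exact: mX.
    + by apply: measurableU; exact: measurableU.
    apply: filterS2 XE (jump_integral_pos_neg HN mD mid s0 ga gb) => w Xw Jw /= ew.
    have [|n1] := pselect (A1 w); first by left; left.
    have [|n2] := pselect (A2 w); first by left; right.
    have [|n3] := pselect (A3 w); first by right; left.
    have [|n4] := pselect (A4 w); first by right; right.
    exfalso; move: ew n1 n2 n3 n4.
    rewrite /A1 /A2 /A3 /A4 /= Xw// Jw.
    set x := sigma * B s w; set y := M s w.
    set z := jump_integral X D (funrpos id) s w.
    set z' := jump_integral X D (funrneg id) s w.
    move=> ew /negP; rewrite -leNgt => xl /negP; rewrite -leNgt => yl.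
    move=> /negP; rewrite -leNgt => zl /negP; rewrite -leNgt => zl'.
    move: ew; rewrite ltNge => /negP; apply.
    have -> : mu * s + x + y + (z - z') - (mu + (a - b)) * s =
      x + y + (z - s * a) + - (z' - s * b) by ring.
    rewrite (le_trans (ler_normD _ _))// normrN.
    have := ler_normD (x + y) (z - s * a); have := ler_normD x y.
    lra.
  apply: (le_trans (measureU2 P (measurableU _ _ mA1 mA2) (measurableU _ _ mA3 mA4))).
  apply: leeD.
    apply: (le_trans (measureU2 P mA1 mA2)); apply: leeD.
      apply: chebyshev_power_scale => //; last exact: HB.
      by apply: measurable_funM => //; exact: mB.
    by apply: chebyshev_power_scale => //; [exact: mM|exact: HC].
  apply: (le_trans (measureU2 P mA3 mA4)); apply: leeD; [exact: Hp1|exact: Hp2].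
Qed.

End levy_ito_process.

Theorem theorem4p4 (R : realType) (d : measure_display) (T : measurableType d)
    (P : probability T R) (X B : R -> T -> R)
    (F : {measure set R -> \bar R}) (mu sigma f : R)
    (sigma_ge0 : 0 <= sigma)
    (X_levy : levy_process P X)
    (X_decomposition : levy_ito_decomposition P X mu sigma B F)
    (f01 : 0 <= f <= 1)
    (X1_integrable : ('E_P[(fun w => `|X 1 w|)%R] < +oo)%E) :
  {ae P, forall w,
    ln (wealth X sigma f t w) / t @[t --> +oo] -->
      f * (mu + \int[F]_(x in [set x | 1 < `|x|]) x)
      + f * (1 - f) * sigma ^+ 2 / 2
      + \int[F]_(x in ~` [set 0]) log_jump f x}.
Proof.
case: X_decomposition => F_levy HB HN _ [M HM XE].
have big := big_jumps_integrable X_levy F_levy HB HN HM XE X1_integrable.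
have small := small_jump_variance_finite (levy_measure_integrable F_levy).
have logoo := log_jump_integrable f01 small big.
(* Finiteness ensures that the real integral in the limit is the true mean and not the default value
   0. *)
have logE : (\int[F]_(x in ~` [set 0%R]) (log_jump f x)%:E =
    (\int[F]_(x in ~` [set 0]) log_jump f x)%:E)%E.
  rewrite /Rintegral fineK// ge0_fin_numE// integral_ge0// => x _.
  by rewrite lee_fin log_jump_ge0.
have mc : measurable (~` [set 0 : R]) by exact: measurableC.
have avgJ := jump_integral_average HN mc (measurable_log_jump f)
  (log_jump_ge0 f01) logE.
have avgX := levy_ito_average X_levy F_levy HB HN HM XE X1_integrable.
apply: filterS2 avgX avgJ => w Xw Jw.
have cE : \forall t \near +oo,
    f * (X t w / t) + f * (1 - f) * sigma ^+ 2 / 2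
    + jump_integral X (~` [set 0]) (log_jump f) t w / t
    = ln (wealth X sigma f t w) / t.
  near=> t; have t0 : 0 < t by near: t; exact: nbhs_pinfty_gt.
  by rewrite /wealth expRK; field; rewrite gt_eqF.
apply: cvg_trans (near_eq_cvg cE) _.
apply: cvgD => //; apply: cvgD; last exact: cvg_cst.
by apply: cvgM => //; exact: cvg_cst.
Unshelve. all: by end_near. Qed.
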